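(* Let $k$ be an algebraically closed field of characteristic zero and let $H$ be a Hopf algebra over $k$. Suppose that $H=\otimes_{i=1}^r K_i$ and $H=\otimes_{j=1}^s L_j$ are two Krull-Schmidt-Remak type decompositions of $H$. Then $r=s$ and there is a permutation $\sigma$ of $\{1,\dots,r\}$ such that $K_i\cong L_{\sigma(i)}$.
   Context: A Hopf subalgebra $A\subseteq H$ is normal if $h_1 A S(h_2)\subseteq A$ and $S(h_1)Ah_2\subseteq A$ for all $h\in H$ (Sweedler notation, $S$ the antipode). A Hopf algebra is simple if it does not contain proper normal Hopf subalgebras, i.e. normal Hopf subalgebras other than the trivial one $k=k1$ and itself. For a family $\{K_\lambda\}_{\lambda\in\Lambda}$ of Hopf subalgebras of $H$, $\langle K_\lambda\mid\lambda\in\Lambda\rangle$ denotes the Hopf subalgebra of $H$ they generate (it coincides with the subalgebra they generate). $H$ is the internal tensor product of the family of Hopf subalgebras $\{K_\lambda\}_{\lambda\in\Lambda}$, written $H=\otimes_{\lambda\in\Lambda}K_\lambda$, if $H=\langle K_\lambda\mid\lambda\in\Lambda\rangle$ and $K_\mu\cap\langle K_\lambda\mid\lambda\ne\mu\rangle=k$ for all $\mu\in\Lambda$. A Krull-Schmidt-Remak type decomposition of $H$ is an expression $H=\otimes_{\lambda\in\Lambda}K_\lambda$ as an internal tensor product in which the $K_\lambda$ are simple semisimple Hopf algebras. The isomorphisms $\cong$ are isomorphisms of Hopf algebras.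
   Formalization: The factors of an internal tensor product are required to be normal Hopf subalgebras (otherwise k[S_3] is a counterexample), and a simple Hopf algebra is required to be different from k (otherwise H = H ⊗ k gives r = 1, s = 2). *)

(* Defs.v *)
From HB Require Import structures.
From mathcomp Require Import all_boot all_order all_algebra all_fingroup.
From mathcomp Require Import generic_quotient.
From mathcomp Require Import boolp classical_sets.

Set Implicit Arguments.
Unset Strict Implicit.
Unset Printing Implicit Defensive.

Import GRing.Theory.

Local Open Scope ring_scope.
Local Open Scope quotient_scope.

Section TensorProduct.
Context (k : fieldType) (U V : lmodType k).

(* U (x) V is the set of formal sums of pairs modulo the congruence generated
   by commutativity of formal sums and bilinearity. *)
Inductive tensor_rel : seq (U * V) -> seq (U * V) -> Prop :=
| tensor_rel_refl s : tensor_rel s s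
| tensor_rel_sym s t : tensor_rel s t -> tensor_rel t s
| tensor_rel_trans s t u : tensor_rel s t -> tensor_rel t u -> tensor_rel s u
| tensor_rel_cat s s' t t' :
    tensor_rel s s' -> tensor_rel t t' -> tensor_rel (s ++ t) (s' ++ t')
| tensor_rel_catC s t : tensor_rel (s ++ t) (t ++ s)
| tensor_rel_zero v : tensor_rel [:: (0, v)] [::]
| tensor_rel_addl u u' v : tensor_rel [:: (u + u', v)] [:: (u, v); (u', v)]
| tensor_rel_addr u v v' : tensor_rel [:: (u, v + v')] [:: (u, v); (u, v')]
| tensor_rel_scale a u v : tensor_rel [:: (a *: u, v)] [:: (u, a *: v)].

Definition tensor_relb (s t : seq (U * V)) : bool := `[< tensor_rel s t >].

Lemma tensor_relb_equiv : equiv_class_of tensor_relb.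
Proof.
split=> [s|s t|t s u].
- exact/asboolP/tensor_rel_refl.
- by apply/asboolP/asboolP; exact: tensor_rel_sym.
- by move=> /asboolP st /asboolP tu; apply/asboolP; exact: tensor_rel_trans st tu.
Qed.

Canonical tensor_equiv := EquivRelPack tensor_relb_equiv.

Definition tensor : Type := {eq_quot tensor_equiv}.
HB.instance Definition _ := Choice.on tensor.
HB.instance Definition _ := EqQuotient.on tensor.

Lemma tensor_piP (s t : seq (U * V)) :
  (\pi_tensor s = \pi_tensor t) <-> tensor_rel s t.
Proof.
split=> [/eqmodP/asboolP //|st]; exact/eqmodP/asboolP.
Qed.

Lemma tensor_reprK (s : seq (U * V)) : tensor_rel (repr (\pi_tensor s)) s.
Proof. by apply/tensor_piP; rewrite reprK. Qed.

Lemma tensor_piW (P : tensor -> Prop) :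
  (forall s, P (\pi_tensor s)) -> forall x, P x.
Proof. by move=> Ppi x; rewrite -[x]reprK. Qed.

Definition tensor_zero : tensor := \pi_tensor [::].
Definition tensor_add (x y : tensor) : tensor := \pi_tensor (repr x ++ repr y).
Definition tensor_scale (a : k) (x : tensor) : tensor :=
  \pi_tensor [seq (a *: p.1, p.2) | p <- repr x].
Definition tensor_opp (x : tensor) : tensor := tensor_scale (- 1) x.

Lemma tensor_add_pi s t :
  tensor_add (\pi_tensor s) (\pi_tensor t) = \pi_tensor (s ++ t).
Proof. by apply/tensor_piP/tensor_rel_cat; exact: tensor_reprK. Qed.

Lemma tensor_rel_map a s t : tensor_rel s t ->
  tensor_rel [seq (a *: p.1, p.2) | p <- s] [seq (a *: p.1, p.2) | p <- t].
Proof.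
elim=> {s t} /=.
- by move=> s; exact: tensor_rel_refl.
- by move=> s t _; exact: tensor_rel_sym.
- by move=> s t u _ st _ tu; exact: tensor_rel_trans st tu.
- by move=> s s' t t' _ ss' _ tt'; rewrite !map_cat; exact: tensor_rel_cat.
- by move=> s t; rewrite !map_cat; exact: tensor_rel_catC.
- by move=> v; rewrite scaler0; exact: tensor_rel_zero.
- by move=> u u' v; rewrite scalerDr; exact: tensor_rel_addl.
- by move=> u v v'; exact: tensor_rel_addr.
- by move=> b u v; rewrite scalerA mulrC -scalerA; exact: tensor_rel_scale.
Qed.

Lemma tensor_scale_pi a s :
  tensor_scale a (\pi_tensor s) = \pi_tensor [seq (a *: p.1, p.2) | p <- s].
Proof. by apply/tensor_piP/tensor_rel_map; exact: tensor_reprK. Qed.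

Lemma tensor_addA : associative tensor_add.
Proof.
by do 3![apply: tensor_piW => ?]; rewrite !tensor_add_pi catA.
Qed.

Lemma tensor_addC : commutative tensor_add.
Proof.
do 2![apply: tensor_piW => ?]; rewrite !tensor_add_pi.
exact/tensor_piP/tensor_rel_catC.
Qed.

Lemma tensor_add0 : left_id tensor_zero tensor_add.
Proof. by apply: tensor_piW => s; rewrite tensor_add_pi. Qed.

Lemma tensor_scaleA a b x :
  tensor_scale a (tensor_scale b x) = tensor_scale (a * b) x.
Proof.
move: x; apply: tensor_piW => s; rewrite !tensor_scale_pi -map_comp; congr (\pi_tensor _).
by apply: eq_map => p /=; rewrite scalerA.
Qed.

Lemma tensor_scale1 : left_id 1 tensor_scale.
Proof.
apply: tensor_piW => s; rewrite tensor_scale_pi; congr (\pi_tensor _).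
by rewrite -[RHS]map_id; apply: eq_map => -[u v] /=; rewrite scale1r.
Qed.

Lemma tensor_scaleDr a : {morph tensor_scale a : x y / tensor_add x y}.
Proof.
by do 2![apply: tensor_piW => ?];
   rewrite tensor_add_pi !tensor_scale_pi tensor_add_pi map_cat.
Qed.

Lemma tensor_scaleDl x : {morph tensor_scale^~ x : a b / a + b >-> tensor_add a b}.
Proof.
move=> a b; move: x; apply: tensor_piW => s; rewrite !tensor_scale_pi tensor_add_pi.
apply/tensor_piP; elim: s => [|[u v] s IHs] /=; first exact: tensor_rel_refl.
pose f c := [seq (c *: p.1, p.2) | p <- s].
change (tensor_rel ([:: ((a + b) *: u, v)] ++ f (a + b))
                   ([:: (a *: u, v)] ++ f a ++ [:: (b *: u, v)] ++ f b)).
apply: (@tensor_rel_trans _ ([:: (a *: u, v); (b *: u, v)] ++ (f a ++ f b))).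
  by apply: tensor_rel_cat IHs; rewrite scalerDl; exact: tensor_rel_addl.
apply: (@tensor_rel_cat [:: (a *: u, v)] _ ([:: (b *: u, v)] ++ f a ++ f b)); first exact: tensor_rel_refl.
by rewrite !catA; apply: tensor_rel_cat (tensor_rel_catC _ _) (tensor_rel_refl _).
Qed.

Lemma tensor_scale0 x : tensor_scale 0 x = tensor_zero.
Proof.
move: x; apply: tensor_piW => s; rewrite tensor_scale_pi; apply/tensor_piP.
elim: s => [|[u v] s IHs] /=; first exact: tensor_rel_refl.
rewrite scale0r.
exact: (@tensor_rel_cat [:: (0, v)] [::] _ [::] (tensor_rel_zero v) IHs).
Qed.

Lemma tensor_addN : left_inverse tensor_zero tensor_opp tensor_add.
Proof.
move=> x; rewrite -[in X in tensor_add _ X](tensor_scale1 x).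
by rewrite -tensor_scaleDl addNr tensor_scale0.
Qed.

HB.instance Definition _ := GRing.isZmodule.Build tensor
  tensor_addA tensor_addC tensor_add0 tensor_addN.
HB.instance Definition _ := GRing.Zmodule_isLmodule.Build k tensor
  tensor_scaleA tensor_scale1 tensor_scaleDr tensor_scaleDl.

Definition tens (u : U) (v : V) : tensor := \pi_tensor [:: (u, v)].

(* Evaluation of b at a formal sum representing t.  This does not depend on the
   representative when b is bilinear, see tensor_lift_sum; tensor_lift is only
   used on such b. *)
Definition tensor_lift (W : lmodType k) (b : U -> V -> W) (t : tensor) : W :=
  \sum_(p <- repr t) b p.1 p.2.

Definition bilin (W : lmodType k) (b : U -> V -> W) :=
  (forall v, linear (b^~ v)) /\ (forall u, linear (b u)).

End TensorProduct.

Notation "u ⊗ v" := (tens u v) (at level 40, left associativity) : ring_scope.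

Section LinearProp.
Context (k : fieldType) (U V W : lmodType k) (f : U -> V).
Hypothesis lf : linear f.

Lemma lin0 : f 0 = 0.
Proof. by have := lf (-1) 0 0; rewrite scaler0 addr0 scaleN1r addNr. Qed.

Lemma linD x y : f (x + y) = f x + f y.
Proof. by have := lf 1 x y; rewrite !scale1r. Qed.

Lemma linZ a x : f (a *: x) = a *: f x.
Proof. by have := lf a x 0; rewrite !addr0 lin0 addr0. Qed.

Lemma lin_sum I (r : seq I) (F : I -> U) :
  f (\sum_(i <- r) F i) = \sum_(i <- r) f (F i).
Proof. exact: (big_morph f linD lin0). Qed.

Lemma lin_comp (g : V -> W) : linear g -> linear (g \o f).
Proof. by move=> lg a x y /=; rewrite lf lg. Qed.

End LinearProp.

Section TensorTheory.
Context (k : fieldType) (U V : lmodType k).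
Implicit Types (W : lmodType k) (t : tensor U V).

Lemma tensDl u u' (v : V) : (u + u' : U) ⊗ v = u ⊗ v + u' ⊗ v.
Proof.
rewrite [RHS]tensor_add_pi; exact/tensor_piP/tensor_rel_addl.
Qed.

Lemma tensDr (u : U) (v v' : V) : u ⊗ (v + v') = u ⊗ v + u ⊗ v'.
Proof.
rewrite [RHS]tensor_add_pi; exact/tensor_piP/tensor_rel_addr.
Qed.

Lemma tensZl a (u : U) (v : V) : (a *: u) ⊗ v = a *: (u ⊗ v).
Proof. by rewrite [RHS]tensor_scale_pi. Qed.

Lemma tensZr a (u : U) (v : V) : u ⊗ (a *: v) = a *: (u ⊗ v).
Proof.
by rewrite -tensZl; apply/esym/tensor_piP/tensor_rel_scale.
Qed.

Lemma tens_bilin : bilin (@tens k U V).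
Proof.
by split=> w a x y /=; rewrite ?tensDl ?tensDr ?tensZl ?tensZr.
Qed.

Lemma tensor_pi_sum (s : seq (U * V)) :
  \pi_(tensor U V) s = \sum_(p <- s) p.1 ⊗ p.2.
Proof.
elim: s => [|[u v] s IHs]; first by rewrite big_nil.
by rewrite big_cons -IHs [RHS]tensor_add_pi.
Qed.

Lemma tensor_sumP t : exists s : seq (U * V), t = \sum_(p <- s) p.1 ⊗ p.2.
Proof. by exists (repr t); rewrite -tensor_pi_sum reprK. Qed.

Lemma tensor_lift_pi W (b : U -> V -> W) s :
  bilin b -> tensor_lift b (\pi_(tensor U V) s) = \sum_(p <- s) b p.1 p.2.
Proof.
move=> [bl br].
suff E s1 s2 : tensor_rel s1 s2 ->
    \sum_(p <- s1) b p.1 p.2 = \sum_(p <- s2) b p.1 p.2.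
  exact/E/tensor_reprK.
elim=> {s s1 s2} //=.
- by move=> s t u _ -> _ ->.
- by move=> s s' t t' _ e _ e'; rewrite !big_cat /= e e'.
- by move=> s t; rewrite !big_cat /= addrC.
- by move=> v; rewrite big_seq1 big_nil (lin0 (bl v)).
- by move=> u u' v; rewrite !big_cons !big_nil !addr0 /= (linD (bl v)).
- by move=> u v v'; rewrite !big_cons !big_nil !addr0 /= (linD (br u)).
- by move=> a u v; rewrite !big_seq1 /= (linZ (bl v)) (linZ (br u)).
Qed.

Lemma tensor_lift_sum W (b : U -> V -> W) (s : seq (U * V)) : bilin b ->
  tensor_lift b (\sum_(p <- s) p.1 ⊗ p.2) = \sum_(p <- s) b p.1 p.2.
Proof. by move=> bb; rewrite -tensor_pi_sum tensor_lift_pi. Qed.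

Lemma tensor_lift_tens W (b : U -> V -> W) u v : bilin b ->
  tensor_lift b (u ⊗ v) = b u v.
Proof. by move=> bb; rewrite tensor_lift_pi// big_seq1. Qed.

Lemma tensor_lift_linear W (b : U -> V -> W) :
  bilin b -> linear (tensor_lift b).
Proof.
move=> bb a x y; have [[s ->] [t ->]] := (tensor_sumP x, tensor_sumP y).
rewrite scaler_sumr.
have -> : \sum_(p <- s) a *: (p.1 ⊗ p.2) =
          \sum_(p <- [seq (a *: q.1, q.2) | q <- s]) p.1 ⊗ p.2 :> tensor U V.
  by rewrite big_map; apply: eq_bigr => p _; rewrite tensZl.
rewrite -big_cat !tensor_lift_sum// big_cat big_map scaler_sumr; congr (_ + _).
by apply: eq_bigr => p _; case: bb => bl _; rewrite (linZ (bl p.2)).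
Qed.

Lemma tensor_linear_ext W (f g : tensor U V -> W) : linear f -> linear g ->
  (forall u v, f (u ⊗ v) = g (u ⊗ v)) -> f =1 g.
Proof.
move=> lf lg fg t; have [s ->] := tensor_sumP t.
by rewrite (lin_sum lf) (lin_sum lg); apply: eq_bigr => p _; exact: fg.
Qed.

Lemma linear_lift W W' (f : W -> W') (b : U -> V -> W) t :
  linear f -> f (tensor_lift b t) = tensor_lift (fun u v => f (b u v)) t.
Proof. by move=> lf; rewrite /tensor_lift (lin_sum lf). Qed.

End TensorTheory.

Section TensorMap.
Context (k : fieldType).

Definition tensor_map (U V U' V' : lmodType k) (f : U -> U') (g : V -> V') :
    tensor U V -> tensor U' V' :=
  tensor_lift (fun u v => f u ⊗ g v).

Definition tensor_assoc (U V W : lmodType k) :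
    tensor (tensor U V) W -> tensor U (tensor V W) :=
  tensor_lift (fun t w => tensor_lift (fun u v => u ⊗ (v ⊗ w)) t).

Definition tensor_mul (A B : algType k) (x y : tensor A B) : tensor A B :=
  tensor_lift (fun a b => tensor_lift (fun c d => (a * c) ⊗ (b * d)) y) x.

Section Map.
Context (U V U' V' : lmodType k) (f : U -> U') (g : V -> V').
Hypotheses (lf : linear f) (lg : linear g).

Lemma tensor_map_bilin : bilin (fun u v => f u ⊗ g v).
Proof.
by split=> w a x y /=; rewrite ?lf ?lg ?tensDl ?tensDr ?tensZl ?tensZr.
Qed.

Lemma tensor_map_tens u v : tensor_map f g (u ⊗ v) = f u ⊗ g v.
Proof. exact/tensor_lift_tens/tensor_map_bilin. Qed.

Lemma tensor_map_linear : linear (tensor_map f g).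
Proof. exact/tensor_lift_linear/tensor_map_bilin. Qed.

End Map.

Lemma tensor_map_comp (U V U' V' U2 V2 : lmodType k)
    (f : U -> U') (g : V -> V') (f' : U' -> U2) (g' : V' -> V2) :
  linear f -> linear g -> linear f' -> linear g' ->
  tensor_map f' g' \o tensor_map f g =1 tensor_map (f' \o f) (g' \o g).
Proof.
move=> lf lg lf' lg'; apply: tensor_linear_ext.
- exact: (lin_comp (tensor_map_linear _ _) (tensor_map_linear _ _)).
- exact: (tensor_map_linear (lin_comp _ _) (lin_comp _ _)).
move=> u v /=; rewrite !tensor_map_tens//; exact: lin_comp.
Qed.

Lemma tensor_map_ext (U V U' V' : lmodType k) (f f' : U -> U')
  (g g' : V -> V') : f =1 f' -> g =1 g' -> tensor_map f g =1 tensor_map f' g'.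
Proof.
by move=> ff' gg' t; apply: eq_bigr => p _; rewrite ff' gg'.
Qed.

Lemma tensor_map_id (U V : lmodType k) (f : U -> U) (g : V -> V) :
  f =1 id -> g =1 id -> tensor_map f g =1 id.
Proof.
move=> fi gi; have lf : linear f by move=> a x y; rewrite !fi.
have lg : linear g by move=> a x y; rewrite !gi.
apply: tensor_linear_ext => // [|u v]; first exact: tensor_map_linear.
by rewrite tensor_map_tens// fi gi.
Qed.

Lemma tensor_lift_map (U V U' V' W : lmodType k) (f : U -> U') (g : V -> V')
    (b : U' -> V' -> W) t : linear f -> linear g -> bilin b ->
  tensor_lift b (tensor_map f g t) = tensor_lift (fun u v => b (f u) (g v)) t.
Proof.
move=> lf lg bb; have [bl br] := bb.
have bfg : bilin (fun u v => b (f u) (g v)).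
  by split=> w a x y /=; rewrite ?lf ?lg ?br ?(bl (g w)).
move: t; apply: (tensor_linear_ext (f := tensor_lift b \o tensor_map f g)).
- exact: (lin_comp (tensor_map_linear _ _) (tensor_lift_linear _)).
- exact: tensor_lift_linear.
by move=> u v /=; rewrite tensor_map_tens// !tensor_lift_tens.
Qed.

Section Assoc.
Context (U V W : lmodType k).

Lemma tensor_assoc_bilin1 (w : W) :
  bilin (fun (u : U) (v : V) => u ⊗ (v ⊗ w)).
Proof. by split=> ? a x y /=; rewrite ?(tensDl, tensDr, tensZl, tensZr). Qed.

Lemma tensor_assoc_bilin :
  bilin (fun (t : tensor U V) (w : W) => tensor_lift (fun u v => u ⊗ (v ⊗ w)) t).
Proof.
split=> [w|t a x y]; first exact/tensor_lift_linear/tensor_assoc_bilin1.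
rewrite /tensor_lift scaler_sumr -big_split; apply: eq_bigr => p _ /=.
by rewrite ?(tensDl, tensDr, tensZl, tensZr).
Qed.

Lemma tensor_assoc_linear : linear (@tensor_assoc U V W).
Proof. exact/tensor_lift_linear/tensor_assoc_bilin. Qed.

Lemma tensor_assoc_tens u v w :
  tensor_assoc ((u ⊗ v) ⊗ w) = u ⊗ (v ⊗ w) :> tensor U (tensor V W).
Proof.
rewrite /tensor_assoc tensor_lift_tens; last exact: tensor_assoc_bilin.
exact/tensor_lift_tens/tensor_assoc_bilin1.
Qed.

End Assoc.

Lemma tensor_assoc_map (U V W U' V' W' : lmodType k)
    (f : U -> U') (g : V -> V') (h : W -> W') :
  linear f -> linear g -> linear h ->
  tensor_map f (tensor_map g h) \o @tensor_assoc U V W =1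
  @tensor_assoc U' V' W' \o tensor_map (tensor_map f g) h.
Proof.
move=> lf lg lh.
have lgh := tensor_map_linear lg lh; have lfg := tensor_map_linear lf lg.
apply: tensor_linear_ext => [||t w].
- exact: (@lin_comp _ _ _ _ _ (@tensor_assoc_linear _ _ _) _ (tensor_map_linear lf lgh)).
- exact: (@lin_comp _ _ _ _ _ (tensor_map_linear lfg lh) _ (@tensor_assoc_linear _ _ _)).
move: t.
apply: (@tensor_linear_ext _ _ _ _
  (fun t => (tensor_map f (tensor_map g h) \o @tensor_assoc U V W) (t ⊗ w))
  (fun t => (@tensor_assoc U' V' W' \o tensor_map (tensor_map f g) h) (t ⊗ w))).
- move=> a x y /=; rewrite tensDl tensZl tensor_assoc_linear.
  exact: tensor_map_linear.
- move=> a x y /=; rewrite tensDl tensZl tensor_map_linear//.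
  exact: tensor_assoc_linear.
move=> u v /=.
by rewrite tensor_assoc_tens !tensor_map_tens// tensor_assoc_tens.
Qed.

Section Mul.
Context (A B : algType k).

Lemma tensor_mul_bilin1 a b :
  bilin (fun (c : A) (d : B) => (a * c) ⊗ (b * d)).
Proof.
by split=> ? e x y /=;
   rewrite mulrDr -scalerAr ?(tensDl, tensDr, tensZl, tensZr).
Qed.

Lemma tensor_mul_bilin (y : tensor A B) :
  bilin (fun (a : A) (b : B) =>
    tensor_lift (fun c d => (a * c) ⊗ (b * d)) y).
Proof.
by split=> ? e x z /=; rewrite /tensor_lift scaler_sumr -big_split;
   apply: eq_bigr => p _; rewrite mulrDl -scalerAl ?(tensDl, tensDr, tensZl, tensZr).
Qed.

Lemma tensor_mul_linearl (y : tensor A B) : linear (@tensor_mul A B ^~ y).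
Proof. exact/tensor_lift_linear/tensor_mul_bilin. Qed.

Lemma tensor_mul_linearr (x : tensor A B) : linear (tensor_mul x).
Proof.
move=> a y z; rewrite /tensor_mul [in RHS]/tensor_lift scaler_sumr -big_split.
by apply: eq_bigr => p _; exact/tensor_lift_linear/tensor_mul_bilin1.
Qed.

Lemma tensor_mul_tens (a c : A) (b d : B) :
  tensor_mul (a ⊗ b) (c ⊗ d) = (a * c) ⊗ (b * d).
Proof.
rewrite /tensor_mul tensor_lift_tens; last exact: tensor_mul_bilin.
exact/tensor_lift_tens/tensor_mul_bilin1.
Qed.

End Mul.

Lemma tensor_map_mul (A B A' B' : algType k) (f : A -> A') (g : B -> B') :
  linear f -> linear g ->
  {morph f : x y / x * y} -> {morph g : x y / x * y} ->
  {morph tensor_map f g : x y / tensor_mul x y}.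
Proof.
move=> lf lg mf mg x y; have lfg := tensor_map_linear lf lg.
have lml := @tensor_mul_linearl; have lmr := @tensor_mul_linearr.
move: x; apply: (@tensor_linear_ext _ _ _ _
  (fun x => tensor_map f g (tensor_mul x y))
  (fun x => tensor_mul (tensor_map f g x) (tensor_map f g y))).
- by move=> a x z /=; rewrite lml lfg.
- by move=> a x z /=; rewrite lfg lml.
move=> a b; move: y; apply: (@tensor_linear_ext _ _ _ _
  (fun y => tensor_map f g (tensor_mul (a ⊗ b) y))
  (fun y => tensor_mul (tensor_map f g (a ⊗ b)) (tensor_map f g y))).
- by move=> e x z /=; rewrite lmr lfg.
- by move=> e x z /=; rewrite lfg lmr.
by move=> c d; rewrite tensor_mul_tens !tensor_map_tens// tensor_mul_tens mf mg.
Qed.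

End TensorMap.

HB.mixin Record Algebra_isHopf (k : fieldType) H of GRing.Algebra k H := {
  comul : {linear H -> tensor H H};
  counit : {linear H -> k^o};
  antipode : {linear H -> H};
  comulA : forall x : H,
    tensor_assoc (tensor_map comul idfun (comul x)) =
    tensor_map idfun comul (comul x);
  counitl : forall x : H,
    tensor_lift (fun a b => counit a *: b) (comul x) = x;
  counitr : forall x : H,
    tensor_lift (fun a b => counit b *: a) (comul x) = x;
  comul1 : comul 1 = 1 ⊗ 1;
  comulM : forall x y : H, comul (x * y) = tensor_mul (comul x) (comul y);
  counit1 : counit 1 = 1;
  counitM : forall x y : H, counit (x * y) = counit x * counit y;
  antipodel : forall x : H,
    tensor_lift (fun a b => antipode a * b) (comul x) = (counit x)%:A;
  antipoder : forall x : H,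
    tensor_lift (fun a b => a * antipode b) (comul x) = (counit x)%:A
}.

#[short(type="hopfAlgType")]
HB.structure Definition HopfAlgebra (k : fieldType) :=
  {H of GRing.Algebra k H & Algebra_isHopf k H}.

Definition hopf_iso (k : fieldType) (H H' : hopfAlgType k) : Prop :=
  exists f : {lrmorphism H -> H'},
    [/\ bijective f,
        forall x, comul (f x) = tensor_map f f (comul x),
        forall x, counit (f x) = counit x &
        forall x, antipode (f x) = f (antipode x)].

(* The condition on comul says that it maps A into the image of A (x) A. *)
Record hopfSub (k : fieldType) (H : hopfAlgType k) := HopfSub {
  hopfSub_pred :> {pred H};
  hopfSub_subalg : GRing.subalg_closed hopfSub_pred;
  hopfSub_comul : forall x, x \in hopfSub_pred ->
    exists2 s : seq (H * H),
      all (fun p => (p.1 \in hopfSub_pred) && (p.2 \in hopfSub_pred)) s &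
      comul x = \sum_(p <- s) p.1 ⊗ p.2;
  hopfSub_antipode : forall x, x \in hopfSub_pred ->
    antipode x \in hopfSub_pred
}.

(* Any subspace is a retract of the ambient space. *)
Section Retraction.
Context (k : fieldType) (W V : lmodType k) (i : W -> V).
Hypotheses (li : linear i) (inj_i : injective i).
Local Open Scope classical_set_scope.

Lemma linear_retraction : exists2 r : V -> W, linear r & cancel i r.
Proof.
pose P (C : set V) := [/\ forall x y, C x -> C y -> C (x + y),
  forall a x, C x -> C (a *: x) & forall w, C (i w) -> i w = 0].
have [F FP totF|C [[CD CZ Ci] maxC]] := @Zorn_bigcup V P.
  split.
  - move=> x y [A FA Ax] [B FB By].
    have [AB|BA] := totF _ _ FA FB.
      by exists B => //; have [+ _ _] := FP _ FB; apply => //; exact: AB.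
    by exists A => //; have [+ _ _] := FP _ FA; apply => //; exact: BA.
  - by move=> a x [A FA Ax]; exists A => //; have [_ + _] := FP _ FA; apply.
  - by move=> w [A FA Ax]; have [_ _ +] := FP _ FA; apply.
pose D v := C v \/ v = 0.
have DD x y : D x -> D y -> D (x + y).
  move=> [Cx|->] [Cy|->]; rewrite ?add0r ?addr0; [left; exact: CD|by left..|].
  by right.
have DZ a x : D x -> D (a *: x).
  by move=> [Cx|->]; [left; exact: CZ|right; rewrite scaler0].
have Di w : D (i w) -> i w = 0 by case=> [/Ci|].
have ex v : exists w, D (v - i w).
  apply: contrapT => nv.
  pose C' := [set x | exists2 p : V * k, D p.1 & x = p.1 + p.2 *: v].
  apply: (maxC C'); first split.
  - by move=> c Cc; exists (c, 0) => /=; [left|rewrite scale0r addr0].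
  - move=> C'C; apply: nv; exists 0; rewrite (lin0 li) subr0; left.
    by apply: C'C; exists (0, 1) => /=; [right|rewrite add0r scale1r].
  split.
  - move=> _ _ [[c a] /= Dc ->] [[d b] /= Dd ->]; exists (c + d, a + b) => /=.
      exact: DD.
    by rewrite addrACA scalerDl.
  - move=> b _ [[c a] /= Dc ->]; exists (b *: c, b * a) => /=; first exact: DZ.
    by rewrite scalerDr scalerA.
  - move=> w [[c a] /= Dc iw].
    have [a0|a0] := eqVneq a 0.
      by apply: Di; rewrite iw a0 scale0r addr0.
    case: nv; exists (a^-1 *: w); rewrite (linZ li) iw scalerDr scalerA.
    rewrite mulVf// scale1r opprD addrCA subrr addr0 -scaleN1r.
    by apply: (DZ); apply: DZ.
pose r v := sval (cid (ex v)).
have Dr v : D (v - i (r v)) by exact: (svalP (cid (ex v))).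
have uniq v w : D (v - i w) -> r v = w.
  move=> Dw; apply: inj_i; apply/eqP; rewrite -subr_eq0 -scaleN1r.
  rewrite -(linZ li) -(linD li); apply/eqP/Di.
  rewrite (linD li) (linZ li) scaleN1r.
  have -> : i (r v) - i w = (v - i w) + (-1) *: (v - i (r v)).
    by rewrite scaleN1r opprB [RHS]addrC addrA subrK.
  by apply: DD => //; apply: DZ.
exists r => [a x y|w]; apply: uniq; last by rewrite subrr; right.
rewrite (linD li) (linZ li) opprD addrACA -scalerBr; apply: DD => //; exact: DZ.
Qed.

End Retraction.

Lemma tensor_map_inj (k : fieldType) (U V U' V' : lmodType k)
    (f : U -> U') (g : V -> V') : linear f -> linear g ->
  injective f -> injective g -> injective (tensor_map f g).
Proof.
move=> lf lg injf injg.
have [r lr rK] := linear_retraction lf injf.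
have [s ls sK] := linear_retraction lg injg.
apply: (can_inj (g := tensor_map r s)) => t.
by rewrite -[LHS]/((_ \o _) t) tensor_map_comp// tensor_map_id.
Qed.

Section HopfSubType.
Context (k : fieldType) (H : hopfAlgType k) (A : hopfSub H).

Inductive hopfSub_of : predArgType := HopfSubOf x & x \in A.
Definition hval (u : hopfSub_of) : H := let: HopfSubOf x _ := u in x.

HB.instance Definition _ := GRing.isSubalgClosed.Build k H (hopfSub_pred A)
  (GRing.subalg_closed_semi (hopfSub_subalg A)).
HB.instance Definition _ := [isSub of hopfSub_of for hval].
HB.instance Definition _ := [Choice of hopfSub_of by <:].
HB.instance Definition _ := [SubChoice_isSubAlgebra of hopfSub_of by <:].

Lemma hval_linear : linear hval. Proof. by []. Qed.
Lemma hval_inj : injective hval. Proof. exact: val_inj. Qed.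
Lemma hval1 : hval 1 = 1. Proof. by []. Qed.
Lemma hvalM x y : hval (x * y) = hval x * hval y. Proof. by []. Qed.

Fact hopfSub_comul_subproof (x : hopfSub_of) :
  exists t : tensor hopfSub_of hopfSub_of,
    tensor_map hval hval t = comul (hval x).
Proof.
case: x => x Ax /=; have [s + ->] := hopfSub_comul Ax.
have lh := tensor_map_linear hval_linear hval_linear.
elim: s => [_|[u v] s IHs] /=; first by exists 0; rewrite big_nil (lin0 lh).
case/andP=> /andP[/= Au Av] /IHs[t tE]; exists (HopfSubOf Au ⊗ HopfSubOf Av + t).
by rewrite big_cons (linD lh) tE tensor_map_tens//; exact: hval_linear.
Qed.

(* The comultiplication, counit and antipode of A are the restrictions of those
   of H; the first one is well defined because A (x) A embeds in H (x) H. *)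
Definition hopfSub_of_comul (x : hopfSub_of) : tensor hopfSub_of hopfSub_of :=
  sval (cid (hopfSub_comul_subproof x)).
Definition hopfSub_of_counit (x : hopfSub_of) : k^o := counit (hval x).
Definition hopfSub_of_antipode (x : hopfSub_of) : hopfSub_of :=
  let: HopfSubOf y Ay := x in HopfSubOf (hopfSub_antipode Ay).

Lemma hval_comul x :
  tensor_map hval hval (hopfSub_of_comul x) = comul (hval x).
Proof. exact: svalP (cid (hopfSub_comul_subproof x)). Qed.

Lemma hval_antipode x : hval (hopfSub_of_antipode x) = antipode (hval x).
Proof. by case: x. Qed.

Let hh_linear := tensor_map_linear hval_linear hval_linear.
Let hh_inj := tensor_map_inj hval_linear hval_linear hval_inj hval_inj.

Fact hopfSub_of_comul_linear : linear hopfSub_of_comul.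
Proof.
move=> a x y; apply: hh_inj.
by rewrite hh_linear !hval_comul hval_linear linearP.
Qed.
HB.instance Definition _ := GRing.isLinear.Build k hopfSub_of
  (tensor hopfSub_of hopfSub_of) _ hopfSub_of_comul hopfSub_of_comul_linear.

Fact hopfSub_of_counit_linear : linear hopfSub_of_counit.
Proof. by move=> a x y; rewrite /hopfSub_of_counit hval_linear linearP. Qed.
HB.instance Definition _ := GRing.isLinear.Build k hopfSub_of k^o _
  hopfSub_of_counit hopfSub_of_counit_linear.

Fact hopfSub_of_antipode_linear : linear hopfSub_of_antipode.
Proof.
move=> a x y; apply: hval_inj.
by rewrite hval_linear !hval_antipode hval_linear linearP.
Qed.
HB.instance Definition _ := GRing.isLinear.Build k hopfSub_of hopfSub_of _
  hopfSub_of_antipode hopfSub_of_antipode_linear.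

Fact hopfSub_of_comulA x :
  tensor_assoc (tensor_map hopfSub_of_comul idfun (hopfSub_of_comul x)) =
  tensor_map idfun hopfSub_of_comul (hopfSub_of_comul x).
Proof.
have lh := hval_linear; have lc := hopfSub_of_comul_linear.
have li (U : lmodType k) : linear (idfun : U -> U) by [].
have lC : linear (comul : H -> _) by exact: linearP.
apply: (tensor_map_inj lh hh_linear hval_inj hh_inj).
have := tensor_assoc_map lh lh lh
  (tensor_map hopfSub_of_comul idfun (hopfSub_of_comul x)).
move=> /= ->.
have := tensor_map_comp lc (li _) hh_linear lh (hopfSub_of_comul x).
move=> /= ->.
have := tensor_map_comp (li _) lc lh hh_linear (hopfSub_of_comul x).
move=> /= ->.
rewrite (tensor_map_ext (f' := comul \o hval) (g' := idfun \o hval))//;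
  last exact: hval_comul.
rewrite [in RHS](tensor_map_ext (f' := idfun \o hval) (g' := comul \o hval))//;
  last exact: hval_comul.
have := tensor_map_comp lh lh lC (li _) (hopfSub_of_comul x).
move=> /= <-.
have := tensor_map_comp lh lh (li _) lC (hopfSub_of_comul x).
move=> /= <-.
by rewrite !hval_comul comulA.
Qed.

Fact hopfSub_of_counitl x :
  tensor_lift (fun a b => hopfSub_of_counit a *: b) (hopfSub_of_comul x) = x.
Proof.
apply: hval_inj; rewrite (linear_lift _ _ hval_linear) -[RHS]counitl.
rewrite -hval_comul tensor_lift_map//; try exact: hval_linear.
by split=> w a u v /=; rewrite ?linearP ?scalerDl ?scalerDr ?scalerA// mulrC.
Qed.

Fact hopfSub_of_counitr x :
  tensor_lift (fun a b => hopfSub_of_counit b *: a) (hopfSub_of_comul x) = x.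
Proof.
apply: hval_inj; rewrite (linear_lift _ _ hval_linear) -[RHS]counitr.
rewrite -hval_comul tensor_lift_map//; try exact: hval_linear.
by split=> w a u v /=; rewrite ?linearP ?scalerDl ?scalerDr ?scalerA// mulrC.
Qed.

Fact hopfSub_of_comul1 : hopfSub_of_comul 1 = 1 ⊗ 1.
Proof.
apply: hh_inj; rewrite hval_comul comul1 tensor_map_tens//; exact: hval_linear.
Qed.

Fact hopfSub_of_comulM x y :
  hopfSub_of_comul (x * y) =
  tensor_mul (hopfSub_of_comul x) (hopfSub_of_comul y).
Proof.
apply: hh_inj.
rewrite (tensor_map_mul hval_linear hval_linear)//; try exact: hvalM.
by rewrite !hval_comul hvalM comulM.
Qed.

Fact hopfSub_of_counit1 : hopfSub_of_counit 1 = 1.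
Proof. exact: counit1. Qed.

Fact hopfSub_of_counitM x y :
  hopfSub_of_counit (x * y) = hopfSub_of_counit x * hopfSub_of_counit y.
Proof. exact: counitM. Qed.

Fact hopfSub_of_antipodel x :
  tensor_lift (fun a b => hopfSub_of_antipode a * b) (hopfSub_of_comul x) =
  (hopfSub_of_counit x)%:A.
Proof.
apply: hval_inj; rewrite (linear_lift _ _ hval_linear).
rewrite (linZ hval_linear) hval1 -[RHS]antipodel -hval_comul.
rewrite tensor_lift_map; try exact: hval_linear.
  by apply: eq_bigr => p _; rewrite hvalM hval_antipode.
by split=> w a u v /=; rewrite ?linearP ?mulrDl ?mulrDr -?scalerAl -?scalerAr.
Qed.

Fact hopfSub_of_antipoder x :
  tensor_lift (fun a b => a * hopfSub_of_antipode b) (hopfSub_of_comul x) =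
  (hopfSub_of_counit x)%:A.
Proof.
apply: hval_inj; rewrite (linear_lift _ _ hval_linear).
rewrite (linZ hval_linear) hval1 -[RHS]antipoder -hval_comul.
rewrite tensor_lift_map; try exact: hval_linear.
  by apply: eq_bigr => p _; rewrite hvalM hval_antipode.
by split=> w a u v /=; rewrite ?linearP ?mulrDl ?mulrDr -?scalerAl -?scalerAr.
Qed.

HB.instance Definition _ := Algebra_isHopf.Build k hopfSub_of
  hopfSub_of_comulA hopfSub_of_counitl hopfSub_of_counitr
  hopfSub_of_comul1 hopfSub_of_comulM hopfSub_of_counit1 hopfSub_of_counitM
  hopfSub_of_antipodel hopfSub_of_antipoder.

End HopfSubType.

Section Decomposition.
Context (k : fieldType).

Definition normal_hopfSub (H : hopfAlgType k) (A : hopfSub H) : Prop :=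
  forall h a : H, a \in A ->
    tensor_lift (fun x y => x * a * antipode y) (comul h) \in A /\
    tensor_lift (fun x y => antipode x * a * y) (comul h) \in A.

Definition trivial_hopfSub (H : hopfAlgType k) (A : hopfSub H) : Prop :=
  forall x : H, x \in A -> exists c : k, x = c%:A.

(* As usual for simple objects, k itself is excluded: H = H (x) k would otherwise
   be a second decomposition of any simple H. *)
Definition simple_hopf (H : hopfAlgType k) : Prop :=
  (exists x : H, forall c : k, x <> c%:A) /\
  (forall A : hopfSub H, normal_hopfSub A ->
     trivial_hopfSub A \/ forall x : H, x \in A).

Definition left_ideal (R : algType k) (I : set R) : Prop :=
  [/\ I 0, forall x y, I x -> I y -> I (x + y) &
      forall a x, I x -> I (a * x)].

(* The left regular module is semisimple: every submodule is a direct summand. *)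
Definition semisimple_alg (R : algType k) : Prop :=
  forall I : set R, left_ideal I ->
    exists J : set R, [/\ left_ideal J,
      forall x, I x -> J x -> x = 0 &
      forall x, exists y z, [/\ I y, J z & x = y + z]].

(* The smallest Hopf subalgebra of H containing the F i with P i. *)
Definition hopf_gen (H : hopfAlgType k) (I : Type) (P : set I)
    (F : I -> hopfSub H) : set H :=
  fun x => forall A : hopfSub H,
    (forall i, P i -> {subset F i <= A}) -> x \in A.

(* As for internal direct products of groups, the factors are required to be
   normal; together with the intersection condition this forces distinct factors
   to commute elementwise.  Without it, k[S_3] would be "the internal tensor
   product" both of k[C_2] and k[C_3] and of two copies of k[C_2]. *)
Definition internal_tensor (H : hopfAlgType k) (I : Type)
    (F : I -> hopfSub H) : Prop :=
  [/\ forall i, normal_hopfSub (F i),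
      forall x : H, hopf_gen setT F x &
      forall i (x : H), x \in F i -> hopf_gen (fun j => j <> i) F x ->
        exists c : k, x = c%:A].

Definition KSR_decomposition (H : hopfAlgType k) (I : Type)
    (F : I -> hopfSub H) : Prop :=
  internal_tensor F /\
  forall i, simple_hopf (hopfSub_of (F i)) /\ semisimple_alg (hopfSub_of (F i)).

End Decomposition.

(* Main.v *)
(* Normal Hopf subalgebras A, B with A \cap B = k commute elementwise, because the
   Hopf commutator a_1 b_1 S(a_2) S(b_2) lies in A \cap B.  Semisimplicity gives
   every factor a two-sided integral of counit 1, and the product of such integrals
   is one for a product of commuting factors.  An integral yields a nonzero
   invariant functional, hence a nondegenerate one; this shows that right
   multiplication by the integral p of B is injective on A when A \cap B = k, so
   that Ap = ABp carries a projection AB -> A.  Simple factors then satisfy the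
   Steinitz exchange property: if L is contained in BK and meets B trivially, then
   BL = BK, and K and L are isomorphic since Kp = Lp.  The two decompositions are
   compared as two bases of a matroid. *)
Require Import Defs.
From HB Require Import structures.
From mathcomp Require Import all_boot all_order all_algebra all_fingroup.
From mathcomp Require Import boolp classical_sets.

Set Implicit Arguments.
Unset Strict Implicit.
Unset Printing Implicit Defensive.

Import GRing.Theory.

Local Open Scope ring_scope.

(** Neither H nor a factor comes with a basis or a dimension, so the finite-dimensional theory of
    integrals is replaced by arguments inside a single coproduct: a shortest expression of a tensor
    has legs that admit dual functionals, and these do the work of a basis. Quotients are avoided as
    well. The quotient of AB by the ideal generated by the augmentation ideal of B is realised as
    ABp, because b p = counit(b) p; injectivity of a -> a p on A then says that A maps
    isomorphically onto it. Hence two complements of the same B are isomorphic, and the structure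
    maps are compared after multiplication by p. The exchange takes place over a product B of
    factors already adjoined, which in general is not simple; therefore only normality and the
    existence of an integral are carried along for B. *)

(** * Linearity of expressions in Sweedler notation *)

Section LinearClosure.
Context (k : fieldType).

Lemma linear_idf (U : lmodType k) : linear (fun x : U => x). Proof. by []. Qed.

Lemma linear_compf (U V W : lmodType k) (g : V -> W) (f : U -> V) :
  linear g -> linear f -> linear (fun x => g (f x)).
Proof. by move=> lg lf a x y; rewrite lf lg. Qed.

Lemma linear_mull (U : lmodType k) (A : algType k) (f : U -> A) c :
  linear f -> linear (fun x => f x * c).
Proof. by move=> lf a x y; rewrite lf mulrDl scalerAl. Qed.

Lemma linear_mulr (U : lmodType k) (A : algType k) (f : U -> A) c :
  linear f -> linear (fun x => c * f x).
Proof. by move=> lf a x y; rewrite lf mulrDr scalerAr. Qed.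

Lemma linear_scalel (U W : lmodType k) (f : U -> k^o) (w : W) :
  linear f -> linear (fun x => f x *: w).
Proof. by move=> lf a x y; rewrite lf scalerDl scalerA. Qed.

Lemma linear_scaler (U W : lmodType k) c (f : U -> W) : linear f -> linear (fun x => c *: f x).
Proof. by move=> lf a x y; rewrite lf scalerDr !scalerA mulrC. Qed.

Lemma linear_addf (U W : lmodType k) (f g : U -> W) :
  linear f -> linear g -> linear (fun x => f x + g x).
Proof. by move=> lf lg a x y; rewrite lf lg scalerDr addrACA. Qed.

Lemma linear_oppf (U W : lmodType k) (f : U -> W) : linear f -> linear (fun x => - f x).
Proof. by move=> lf a x y; rewrite lf opprD scalerN. Qed.

Lemma linear_bigsum (X W : lmodType k) (I : Type) (r : seq I) (f : I -> X -> W) :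
  (forall i, linear (f i)) -> linear (fun x => \sum_(i <- r) f i x).
Proof.
move=> lf a x y; rewrite scaler_sumr -big_split; apply: eq_bigr => i _.
exact: lf.
Qed.

Lemma linear_tensl (X U V : lmodType k) (f : X -> U) (v : V) :
  linear f -> linear (fun x => f x ⊗ v).
Proof. by move=> lf a x y; rewrite lf tensDl tensZl. Qed.

Lemma linear_tensr (X U V : lmodType k) (f : X -> V) (u : U) :
  linear f -> linear (fun x => u ⊗ f x).
Proof. by move=> lf a x y; rewrite lf tensDr tensZr. Qed.

Lemma linear_lift_fun (X U V W : lmodType k) (b : X -> U -> V -> W) t :
  (forall u v, linear (fun x => b x u v)) -> linear (fun x => tensor_lift (b x) t).
Proof.
move=> lb; apply: (@linear_bigsum _ _ _ _ (fun p x => b x p.1 p.2)) => p.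
exact: lb.
Qed.

Lemma linear_lift_arg (X U V W : lmodType k) (b : U -> V -> W) (f : X -> tensor U V) :
  bilin b -> linear f -> linear (fun x => tensor_lift b (f x)).
Proof. by move=> bb; apply: linear_compf; exact: tensor_lift_linear. Qed.

Lemma eq_tensor_lift (U V W : lmodType k) (b b' : U -> V -> W) t :
  (forall u v, b u v = b' u v) -> tensor_lift b t = tensor_lift b' t.
Proof. by move=> bb'; apply: eq_bigr => p _. Qed.

Definition sweedler (H : hopfAlgType k) (W : lmodType k) (x : H)
  (b : H -> H -> W) : W := tensor_lift b (comul x).

Lemma linear_sweedler_fun (H : hopfAlgType k) (X W : lmodType k)
    (b : X -> H -> H -> W) t :
  (forall u v, linear (fun x => b x u v)) -> linear (fun x => sweedler t (b x)).
Proof. exact: linear_lift_fun. Qed.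

Lemma linear_sweedler_arg (H : hopfAlgType k) (X W : lmodType k)
    (b : H -> H -> W) (f : X -> H) :
  bilin b -> linear f -> linear (fun x => sweedler (f x) b).
Proof.
move=> bb lf; apply: linear_lift_arg => //.
by apply: (linear_compf (g := comul)) => //; exact: linearP.
Qed.

Lemma eq_sweedler (H : hopfAlgType k) (W : lmodType k) (b b' : H -> H -> W) x :
  (forall u v, b u v = b' u v) -> sweedler x b = sweedler x b'.
Proof. exact: eq_tensor_lift. Qed.

Lemma sweedler_eq0 (H : hopfAlgType k) (W : lmodType k) (b : H -> H -> W) x :
  (forall u v, b u v = 0) -> sweedler x b = 0.
Proof. by move=> b0; rewrite /sweedler /tensor_lift big1. Qed.

Lemma sweedlerD (H : hopfAlgType k) (W : lmodType k) (b b' : H -> H -> W) x :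
  sweedler x (fun u v => b u v + b' u v) = sweedler x b + sweedler x b'.
Proof. exact: big_split. Qed.

Lemma sweedlerB (H : hopfAlgType k) (W : lmodType k) (b b' : H -> H -> W) x :
  sweedler x (fun u v => b u v - b' u v) = sweedler x b - sweedler x b'.
Proof. exact: sumrB. Qed.

Lemma linear_sweedler (H : hopfAlgType k) (W W' : lmodType k) (f : W -> W')
    (b : H -> H -> W) (x : H) :
  linear f -> f (sweedler x b) = sweedler x (fun u v => f (b u v)).
Proof. exact: linear_lift. Qed.

Lemma exchange_sweedler (H H' : hopfAlgType k) (W : lmodType k)
    (F : H -> H -> H' -> H' -> W) x y :
  sweedler x (fun u v => sweedler y (F u v)) =
  sweedler y (fun a b => sweedler x (fun u v => F u v a b)).
Proof. exact: exchange_big. Qed.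

End LinearClosure.

(** Guards the composition rules of [lin]: with the identity as inner map, the subgoal for the outer
    map would be the goal itself. *)
Ltac is_identity f := lazymatch f with (fun x : ?T => x) => idtac end.

(* Proves linearity and bilinearity of expressions built from products, scalings,
   tensors, nested coproduct sums and linear maps.  A pattern variable may match a
   term mentioning the bound variable, so [match] has to backtrack. *)
Ltac lin :=
  cbv beta;
  first [assumption | by auto |
  match goal with
  | |- bilin _ => split=> ?; lin
  | |- forall _, _ => move=> ?; lin
  | |- GRing.linear_for _ (fun x : ?T => x) => exact: linear_idf
  | |- GRing.linear_for _ (fun x : ?T => @?f x * ?c) => apply: (@linear_mull _ _ _ f c); lin
  | |- GRing.linear_for _ (fun x : ?T => ?c * @?f x) => apply: (@linear_mulr _ _ _ f c); lin
  | |- GRing.linear_for _ (fun x : ?T => ?c *: @?f x) =>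
      first [apply: (@linear_scaler _ _ _ c f) | apply: linear_scaler]; lin
  | |- GRing.linear_for _ (fun x : ?T => @?f x *: ?w) => apply: (@linear_scalel _ _ _ f w); lin
  | |- GRing.linear_for _ (fun x : ?T => @?f x + @?g x) => apply: (@linear_addf _ _ _ f g); lin
  | |- GRing.linear_for _ (fun x : ?T => - @?f x) => apply: (@linear_oppf _ _ _ f); lin
  | |- GRing.linear_for _ (fun x : ?T => @?f x ⊗ ?v) => apply: (@linear_tensl _ _ _ _ f v); lin
  | |- GRing.linear_for _ (fun x : ?T => ?u ⊗ @?f x) => apply: (@linear_tensr _ _ _ _ f u); lin
  | |- GRing.linear_for _ (fun x : ?T => tensor_lift ?b (@?f x)) =>
      apply: (@linear_lift_arg _ _ _ _ _ b f); lin
  | |- GRing.linear_for _ (fun x : ?T => tensor_lift (@?b x) ?t) =>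
      apply: (@linear_lift_fun _ _ _ _ _ b t); lin
  | |- GRing.linear_for _ (fun x : ?T => sweedler (@?f x) ?b) =>
      apply: (@linear_sweedler_arg _ _ _ _ b f); lin
  | |- GRing.linear_for _ (fun x : ?T => sweedler ?t (@?b x)) =>
      apply: (@linear_sweedler_fun _ _ _ _ b t); lin
  | Hb : bilin ?g |- _ => first [exact: (proj1 Hb _) | exact: (proj2 Hb _)]
  | |- GRing.linear_for _ (fun x : ?T => ?g (@?f x)) =>
      tryif is_identity f then exact: linearP
      else (apply: (@linear_compf _ _ _ _ g f); lin)
  | |- GRing.linear_for _ (fun x : ?T => ?g (@?f x) ?c) =>
      tryif is_identity f then fail
      else (apply: (@linear_compf _ _ _ _ (fun y => g y c) f); lin)
  | |- _ => exact: linearP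
  end].

(* \cop (a, b <- x) F is the Sweedler sum of F(x_1, x_2). *)
Notation "'\cop' ( a , b '<-' x ) F" :=
  (sweedler x (fun a b => F))
  (at level 41, a name, b name, x at level 99, F at level 41,
   format "'\cop'  ( a ,  b  '<-'  x )  F") : ring_scope.

(** * Sweedler calculus: coassociativity, cancellation, the antipode *)

Section Sweedler.
Context (k : fieldType) (H : hopfAlgType k).
Implicit Types (x y a : H) (W : lmodType k).

Lemma comul_linear : linear (comul : H -> _). Proof. exact: linearP. Qed.
Lemma counit_linear : linear (counit : H -> _). Proof. exact: linearP. Qed.
Lemma antipode_linear : linear (antipode : H -> _). Proof. exact: linearP. Qed.

Lemma cop_coassoc W (T : H -> H -> H -> W) x :
  (forall b c, linear (fun a => T a b c)) -> (forall a c, linear (fun b => T a b c)) ->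
  (forall a b, linear (T a b)) ->
  \cop (u, c <- x) \cop (a, b <- u) T a b c =
  \cop (a, u <- x) \cop (b, c <- u) T a b c.
Proof.
move=> T1 T2 T3.
pose T' := tensor_lift (fun (u : H) (t : tensor H H) => tensor_lift (fun b c => T u b c) t).
have bT1 c : bilin (fun a b => T a b c) by lin.
have bT2 a : bilin (T a) by lin.
have bT : bilin (fun (u : H) (t : tensor H H) => tensor_lift (fun b c => T u b c) t) by lin.
rewrite /sweedler; have := congr1 T' (comulA x); rewrite /T' tensor_lift_map //;
  last exact: comul_linear.
move=> <-.
have bT4 : bilin (fun (t : tensor H H) c => tensor_lift (fun a b => T a b c) t) by lin.
rewrite -(tensor_lift_map (b := fun t c => tensor_lift (fun a b => T a b c) t)
  (f := comul) (g := idfun)) //;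
  last exact: comul_linear.
move: (tensor_map _ _ _); apply: tensor_linear_ext.
- exact: tensor_lift_linear.
- by apply: linear_compf; [exact: tensor_lift_linear|exact: tensor_assoc_linear].
move=> t c; rewrite tensor_lift_tens //; move: t; apply: tensor_linear_ext.
- exact: tensor_lift_linear.
- apply: (linear_compf (f := fun t => tensor_assoc (t ⊗ c))); first exact: tensor_lift_linear.
  by apply: linear_compf; [exact: tensor_assoc_linear|lin].
by move=> a b; rewrite tensor_assoc_tens !tensor_lift_tens.
Qed.

Lemma copM W (b : H -> H -> W) x y : bilin b ->
  \cop (u, v <- x * y) b u v =
  \cop (x1, x2 <- x) \cop (y1, y2 <- y) b (x1 * y1) (x2 * y2).
Proof.
move=> bb; have [bl br] := bb; rewrite /sweedler comulM /tensor_mul.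
rewrite (linear_lift _ _ (tensor_lift_linear bb)).
apply: eq_tensor_lift => x1 x2; rewrite (linear_lift _ _ (tensor_lift_linear bb)).
by apply: eq_tensor_lift => y1 y2; rewrite tensor_lift_tens.
Qed.

Lemma cop_counitl W (f : H -> W) x : linear f -> \cop (a, b <- x) counit a *: f b = f x.
Proof.
move=> lf; rewrite /sweedler -[in RHS](counitl x) (linear_lift _ _ lf).
by apply: eq_tensor_lift => u v; rewrite (linZ lf).
Qed.

Lemma cop_counitr W (f : H -> W) x : linear f -> \cop (a, b <- x) counit b *: f a = f x.
Proof.
move=> lf; rewrite /sweedler -[in RHS](counitr x) (linear_lift _ _ lf).
by apply: eq_tensor_lift => u v; rewrite (linZ lf).
Qed.

Lemma cop_antipodel W (f : H -> W) x : linear f ->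
  \cop (a, b <- x) f (antipode a * b) = counit x *: f 1.
Proof. by move=> lf; rewrite -linear_sweedler // /sweedler antipodel (linZ lf). Qed.

Lemma cop_antipoder W (f : H -> W) x : linear f ->
  \cop (a, b <- x) f (a * antipode b) = counit x *: f 1.
Proof. by move=> lf; rewrite -linear_sweedler // /sweedler antipoder (linZ lf). Qed.

Lemma cop1 W (b : H -> H -> W) : bilin b -> \cop (x, y <- (1 : H)) b x y = b 1 1.
Proof. by move=> bb; rewrite /sweedler comul1 tensor_lift_tens. Qed.

Section Cancel.
Context (W : lmodType k) (F : H -> H -> W) (x : H).
Hypothesis bF : bilin F.

(** The names of these four lemmas list the maps put on x_1, x_2, x_3. Where this leaves the
    cancelling pair open, [l] and [r] tell whether it is the left or the right one. *)
Lemma cop_S_id_id : \cop (u, v <- x) \cop (a, b <- v) F (antipode u * a) b = F 1 x.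
Proof.
rewrite -(cop_coassoc (T := fun u a b => F (antipode u * a) b)); [|lin..].
under eq_sweedler => u v do rewrite (cop_antipodel u ((proj1 bF) v)).
exact: (cop_counitl x (proj2 bF 1)).
Qed.

Lemma cop_id_S_id_l : \cop (u, v <- x) \cop (a, b <- v) F (u * antipode a) b = F 1 x.
Proof.
rewrite -(cop_coassoc (T := fun u a b => F (u * antipode a) b)); [|lin..].
under eq_sweedler => u v do rewrite (cop_antipoder u ((proj1 bF) v)).
exact: (cop_counitl x (proj2 bF 1)).
Qed.

Lemma cop_id_S_id_r : \cop (u, v <- x) \cop (a, b <- u) F a (antipode b * v) = F x 1.
Proof.
rewrite (cop_coassoc (T := fun u a b => F u (antipode a * b))); [|lin..].
under eq_sweedler => u v do rewrite (cop_antipodel v ((proj2 bF) u)).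
exact: (cop_counitr x (proj1 bF 1)).
Qed.

Lemma cop_id_id_S : \cop (u, v <- x) \cop (a, b <- u) F a (b * antipode v) = F x 1.
Proof.
rewrite (cop_coassoc (T := fun u a b => F u (a * antipode b))); [|lin..].
under eq_sweedler => u v do rewrite (cop_antipoder v ((proj2 bF) u)).
exact: (cop_counitr x (proj1 bF 1)).
Qed.

End Cancel.

Lemma counit_antipode x : counit (antipode x) = counit x.
Proof.
have -> : counit (antipode x) = \cop (a, b <- x) counit (antipode a * b).
  rewrite -[in LHS](cop_counitr x (f := fun y => counit (antipode y))); last by lin.
  by apply: eq_sweedler => u v; rewrite counitM mulrC.
by rewrite (cop_antipodel x counit_linear) counit1 /GRing.scale /= mulr1.
Qed.

(** Both sides are convolution inverse to the multiplication. Spelled out, S(x_1 y_1) x_2 y_2 S(y_3)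
    S(x_3) is evaluated in two ways. *)
Lemma antipodeM x y : antipode (x * y) = antipode y * antipode x.
Proof.
transitivity (\cop (u, v <- x) \cop (c, d <- y) \cop (a, b <- u) \cop (e, g <- c)
   (antipode (a * e) * (b * g) * (antipode d * antipode v))).
  transitivity (\cop (u, v <- x) \cop (a, b <- u) antipode (a * y) * (b * antipode v)).
    rewrite (cop_id_id_S (F := fun a t => antipode (a * y) * t)); last by lin.
    by rewrite mulr1.
  apply: eq_sweedler => u v; rewrite [RHS]exchange_sweedler; apply: eq_sweedler => a b.
  rewrite -[X in _ * (X * _)]mulr1.
  rewrite -(cop_id_id_S y (F := fun c t => antipode (a * c) * (b * t * antipode v))); last by lin.
  apply: eq_sweedler => c d; apply: eq_sweedler => e g.
  by rewrite !mulrA.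
transitivity (\cop (u, v <- x) \cop (c, d <- y)
  (counit u : k) *: ((counit c : k) *: (antipode d * antipode v))).
  apply: eq_sweedler => u v; apply: eq_sweedler => c d.
  rewrite -(copM (b := fun p q => antipode p * q * (antipode d * antipode v))); last by lin.
  rewrite (cop_antipodel (f := fun t => t * (antipode d * antipode v))); last by lin.
  by rewrite mul1r counitM scalerA.
transitivity (\cop (u, v <- x) (counit u : k) *: (antipode y * antipode v)).
  apply: eq_sweedler => u v.
  rewrite -(cop_counitl y (f := fun d => (counit u : k) *: (antipode d * antipode v))); last by lin.
  by apply: eq_sweedler => c d; rewrite !scalerA mulrC.
by rewrite (cop_counitl x (f := fun v => antipode y * antipode v)); last by lin.
Qed.

End Sweedler.

(** * Tensors with independent legs and their dual functionals *)

Section DualRepresentation.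
Context (k : fieldType).

Definition dual_family (U : lmodType k) n (u : 'I_n -> U) (phi : 'I_n -> U -> k^o) :=
  (forall i, linear (phi i)) /\ forall i j, phi i (u j) = (i == j)%:R.

(** An independent family embeds k^n into U, and the coordinates of a linear retraction of this
    embedding are the required functionals on all of U. *)
Lemma free_dual_family (U : lmodType k) n (u : 'I_n -> U) :
  (forall c : 'I_n -> k, \sum_i c i *: u i = 0 -> forall i, c i = 0) ->
  exists phi, dual_family u phi.
Proof.
move=> fu; pose f (c : 'rV[k]_n) := \sum_i c 0 i *: u i.
have lf : linear f.
  move=> a x y; rewrite /f scaler_sumr -big_split; apply: eq_bigr => i _.
  by rewrite !mxE scalerDl scalerA.
have [r lr rK] : exists2 r, linear r & cancel f r.
  apply: linear_retraction => // x y fxy; apply/rowP => i; apply/eqP.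
  rewrite -subr_eq0; apply/eqP.
  have := fu (fun i => x 0 i - y 0 i); apply.
  under eq_bigr do rewrite scalerBl.
  by rewrite sumrB; apply/eqP; rewrite subr_eq0; apply/eqP.
exists (fun i x => r x 0 i); split=> [i a x y|i j].
  by rewrite lr !mxE.
have -> : u j = f (delta_mx 0 j).
  rewrite /f (bigD1 j) //= big1 ?addr0 => [|l lj]; rewrite mxE !eqxx //=.
    by rewrite scale1r.
  by rewrite (negPf lj) scale0r.
by rewrite rK mxE eqxx.
Qed.

(** A relation among the left legs expresses the leg [i0] through the others; absorbing its term
    into the right legs saves one summand. *)
Lemma drop_left_dependent (U V : lmodType k) n (u : 'I_n.+1 -> U) (v : 'I_n.+1 -> V)
    (c : 'I_n.+1 -> k) i0 : \sum_i c i *: u i = 0 -> c i0 != 0 ->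
  \sum_i u i ⊗ v i = \sum_j u (lift i0 j) ⊗ (v (lift i0 j) - (c (lift i0 j) / c i0) *: v i0).
Proof.
move=> cu c0.
have uE : u i0 = \sum_j (- (c (lift i0 j) / c i0)) *: u (lift i0 j).
  move: cu; rewrite (bigD1_ord i0) //= => /eqP; rewrite addr_eq0 => /eqP cu.
  rewrite -[LHS]scale1r -(mulVf c0) -scalerA cu scalerN scaler_sumr -sumrN.
  by apply: eq_bigr => j _; rewrite scalerA scaleNr mulrC.
rewrite (bigD1_ord i0) //= [X in X ⊗ _]uE.
rewrite (lin_sum (f := fun x => x ⊗ v i0)); last by lin.
rewrite -big_split /=; apply: eq_bigr => j _.
by rewrite tensDr tensZl -scaleNr tensZr addrC.
Qed.

Lemma drop_right_dependent (U V : lmodType k) n (u : 'I_n.+1 -> U) (v : 'I_n.+1 -> V)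
    (c : 'I_n.+1 -> k) i0 : \sum_i c i *: v i = 0 -> c i0 != 0 ->
  \sum_i u i ⊗ v i = \sum_j (u (lift i0 j) - (c (lift i0 j) / c i0) *: u i0) ⊗ v (lift i0 j).
Proof.
move=> cv c0.
have vE : v i0 = \sum_j (- (c (lift i0 j) / c i0)) *: v (lift i0 j).
  move: cv; rewrite (bigD1_ord i0) //= => /eqP; rewrite addr_eq0 => /eqP cv.
  rewrite -[LHS]scale1r -(mulVf c0) -scalerA cv scalerN scaler_sumr -sumrN.
  by apply: eq_bigr => j _; rewrite scalerA scaleNr mulrC.
rewrite (bigD1_ord i0) //= [X in _ ⊗ X]vE.
rewrite (lin_sum (f := fun x => u i0 ⊗ x)); last by lin.
rewrite -big_split /=; apply: eq_bigr => j _.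
by rewrite tensDl tensZr -scaleNr tensZl addrC.
Qed.

(* A representation of minimal length has independent left and right legs. *)
Lemma tensor_dual_rep (U V : lmodType k) (t : tensor U V) :
  exists n (u : 'I_n -> U) (v : 'I_n -> V),
    [/\ t = \sum_i u i ⊗ v i, exists phi, dual_family u phi &
        exists psi, dual_family v psi].
Proof.
pose P n := `[< exists (u : 'I_n -> U) (v : 'I_n -> V), t = \sum_i u i ⊗ v i >].
have exP : exists n, P n.
  have [s tE] := tensor_sumP t; exists (size s); apply/asboolP.
  exists (fun i => (nth (0, 0) s i).1), (fun i => (nth (0, 0) s i).2).
  by rewrite tE (big_nth (0, 0)) big_mkord.
case: (ex_minnP exP) => n /asboolP[u [v tE]] minn; exists n, u, v; split=> //.
- apply: free_dual_family => c cu i; apply/eqP/negP => /negP ci.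
  case: n u v c i cu ci tE minn => [|n] u v c i cu ci tE minn; first by case: i ci.
  suff /minn : P n by rewrite ltnn.
  by apply/asboolP; rewrite tE (drop_left_dependent _ cu ci); eexists; eexists.
- apply: free_dual_family => c cu i; apply/eqP/negP => /negP ci.
  case: n u v c i cu ci tE minn => [|n] u v c i cu ci tE minn; first by case: i ci.
  suff /minn : P n by rewrite ltnn.
  by apply/asboolP; rewrite tE (drop_right_dependent _ cu ci); eexists; eexists.
Qed.

Lemma dual_familyE (U W : lmodType k) n (u : 'I_n -> U) phi (w : 'I_n -> W) i :
  dual_family u phi -> \sum_j phi i (u j) *: w j = w i.
Proof.
case=> _ phiu; rewrite (bigD1 i) //= big1 => [|j ji]; rewrite phiu.
  by rewrite eqxx scale1r addr0.
by rewrite eq_sym (negPf ji) scale0r.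
Qed.

Lemma tensor_lift_bigsum (U V W : lmodType k) n (u : 'I_n -> U) (v : 'I_n -> V)
    (b : U -> V -> W) : bilin b ->
  tensor_lift b (\sum_i u i ⊗ v i) = \sum_i b (u i) (v i).
Proof.
move=> bb; rewrite (lin_sum (tensor_lift_linear bb)).
by apply: eq_bigr => i _; rewrite tensor_lift_tens.
Qed.

End DualRepresentation.

(** * Two-sided integrals from semisimplicity *)

Section Integral.
Context (k : fieldType) (H : hopfAlgType k).

(** The kernel of the counit has a complementary left ideal J. The J-component L of 1 has counit 1,
    and a L - counit(a) L lies in both ideals, hence vanishes. *)
Lemma semisimple_integral : semisimple_alg H ->
  exists L : H, [/\ counit L = 1, forall a, a * L = (counit a : k) *: L &
                   forall a, L * a = (counit a : k) *: L].
Proof.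
move=> ssH.
have [|J [[J0 JD JM] IJ0 IJ]] := ssH (fun x : H => counit x = 0).
  split=> [|x y /= x0 y0|a x /= x0]; first by rewrite /= raddf0.
    by rewrite raddfD /= x0 y0 addr0.
  by rewrite counitM x0 mulr0.
have [e [L [e0 JL eL]]] := IJ 1.
have L1 : counit L = 1.
  by have := congr1 counit eL; rewrite counit1 raddfD /= e0 add0r => <-.
have JB x y : J x -> J y -> J (x - y).
  by move=> Jx Jy; apply: JD => //; rewrite -mulN1r; apply: JM.
have left_int a : a * L = (counit a : k) *: L.
  apply/eqP; rewrite -subr_eq0; apply/eqP; apply: IJ0 => /=.
    by rewrite linearB (linZ (@counit_linear _ _)) counitM L1 mulr1 /GRing.scale /= mulr1 subrr.
  by apply: JB; [apply: JM|rewrite -mulr_algl; apply: JM].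
(* The defect t of the right integral property is a left integral of counit 0, so t t = 0 and k t is
   a left ideal. Writing 1 = c t + z with z in a complement gives t = t z, which lies in the
   complement too; so t = 0. *)
exists L; split=> // a; set t := L * a - (counit a : k) *: L.
have t_int b : b * t = (counit b : k) *: t.
  rewrite /t mulrBr mulrA left_int scalerBr -scalerAl; congr (_ - _).
  by rewrite -scalerAr left_int !scalerA mulrC.
have t0 : counit t = 0.
  by rewrite /t linearB (linZ (@counit_linear _ _)) counitM L1 mul1r /GRing.scale /= mulr1 subrr.
suff tt : t = 0 by apply/eqP; rewrite -subr_eq0 -/t tt.
have [|J' [[J'0 J'D J'M] IJ0' IJ']] := ssH (fun x : H => exists c : k, x = c *: t).
  split=> [|x y [c ->] [d ->]|b x [c ->]]; first by exists 0; rewrite scale0r.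
    by exists (c + d); rewrite scalerDl.
  by exists (c * (counit b : k)); rewrite -scalerAr t_int scalerA.
have [y [z [[c yE] J'z E]]] := IJ' 1.
apply: IJ0'; first by exists 1; rewrite scale1r.
rewrite -[t]mulr1 E yE mulrDr -scalerAr t_int t0 scale0r scaler0 add0r.
exact: J'M.
Qed.

Context (L : H).
Hypotheses (L1 : counit L = 1) (Ll : forall a, a * L = (counit a : k) *: L)
  (Lr : forall a, L * a = (counit a : k) *: L).

(** Rewrite L_1 ⊗ a L_2 as S(a_1) a_2 L_1 ⊗ a_3 L_2; the middle part is the coproduct of a_2 L =
    counit(a_2) L. *)
Lemma integral_moveL (W : lmodType k) (F : H -> H -> W) a : bilin F ->
  \cop (u, v <- L) F u (a * v) = \cop (u, v <- L) F (antipode a * u) v.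
Proof.
move=> bF.
transitivity (\cop (a1, a2 <- a) \cop (b1, b2 <- a2) \cop (u, v <- L)
   F (antipode a1 * b1 * u) (b2 * v)).
  rewrite (cop_S_id_id a (F := fun s t => \cop (u, v <- L) F (s * u) (t * v))); last by lin.
  by apply: eq_sweedler => u v; rewrite mul1r.
transitivity (\cop (a1, a2 <- a) (counit a2 : k) *: \cop (u, v <- L) F (antipode a1 * u) v).
  apply: eq_sweedler => a1 a2.
  transitivity (\cop (u, v <- a2 * L) F (antipode a1 * u) v).
    rewrite copM; last by lin.
    by do 2![apply: eq_sweedler => ? ?]; rewrite mulrA.
  rewrite Ll; apply: (linZ (f := fun z => \cop (u, v <- z) F (antipode a1 * u) v)).
  by lin.
rewrite (cop_counitr a (f := fun s => \cop (u, v <- L) F (antipode s * u) v)) //; lin.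
Qed.

Lemma integral_moveR (W : lmodType k) (F : H -> H -> W) a : bilin F ->
  \cop (u, v <- L) F (u * a) v = \cop (u, v <- L) F u (v * antipode a).
Proof.
move=> bF.
transitivity (\cop (a1, a2 <- a) \cop (b1, b2 <- a1) \cop (u, v <- L)
   F (u * b1) (v * (b2 * antipode a2))).
  rewrite (cop_id_id_S a (F := fun s t => \cop (u, v <- L) F (u * s) (v * t))); last by lin.
  by apply: eq_sweedler => u v; rewrite mulr1.
transitivity (\cop (a1, a2 <- a) (counit a1 : k) *: \cop (u, v <- L) F u (v * antipode a2)).
  apply: eq_sweedler => a1 a2.
  transitivity (\cop (u, v <- L * a1) F u (v * antipode a2)).
    rewrite copM; last by lin.
    rewrite exchange_sweedler.
    by do 2![apply: eq_sweedler => ? ?]; rewrite mulrA.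
  rewrite Lr; apply: (linZ (f := fun z => \cop (u, v <- z) F u (v * antipode a2))).
  by lin.
rewrite (cop_counitl a (f := fun s => \cop (u, v <- L) F u (v * antipode s))) //; lin.
Qed.
End Integral.

(** * The invariant functional given by an integral *)

Section Haar.
Context (k : fieldType) (H : hopfAlgType k) (L : H).
Hypotheses (L1 : counit L = 1) (Ll : forall a, a * L = (counit a : k) *: L)
  (Lr : forall a, L * a = (counit a : k) *: L).

(* The elements f(L_1) L_2 form a left ideal by integral_moveL.  If v runs over the
   right legs of comul L, each counit(v) 1 = S(v_1) v_2 lies in it, hence so does 1. *)
Lemma integral_right_legs : exists2 la : H -> k^o, linear la &
  \cop (u, v <- L) (la u : k) *: v = 1.
Proof.
pose P y := exists2 f : H -> k^o, linear f & \cop (u, v <- L) (f u : k) *: v = y.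
have PD x y : P x -> P y -> P (x + y).
  move=> [f lf <-] [g lg <-]; exists (fun z => f z + g z); first by lin.
  by rewrite -sweedlerD; apply: eq_sweedler => u v; rewrite scalerDl.
have P0 : P 0.
  exists (fun=> 0); first by move=> a x y; rewrite scaler0 addr0.
  by apply: sweedler_eq0 => u v; rewrite scale0r.
have Psum n (x : 'I_n -> H) : (forall i, P (x i)) -> P (\sum_i x i).
  by move=> Px; elim/big_ind: _.
have PM a x : P x -> P (a * x).
  move=> [f lf <-]; exists (fun z => f (antipode a * z)); first by lin.
  rewrite -(integral_moveL Ll (F := fun u v => (f u : k) *: v)); last by lin.
  rewrite (linear_sweedler (f := fun z => a * z)); last by lin.
  by apply: eq_sweedler => u v; rewrite scalerAr.
have PZ c x : P x -> P (c *: x) by rewrite -mulr_algl; apply: PM.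
have [n [u [v [LE [phi dphi] _]]]] := tensor_dual_rep (comul L).
have lphi i := dphi.1 i.
have vE i : \cop (a, b <- L) (phi i a : k) *: b = v i.
  rewrite /sweedler LE tensor_lift_bigsum; last by lin.
  exact: dual_familyE dphi.
have Pv i : P (v i) by exists (phi i).
have P1 i : P ((counit (v i) : k) *: 1).
  have <- : \cop (a, b <- v i) antipode a * b = (counit (v i) : k) *: 1.
    exact: (cop_antipodel (f := id)).
  rewrite -vE (linear_sweedler (f := fun z => \cop (a, b <- z) antipode a * b)); last by lin.
  have -> : \cop (a, b <- L) \cop (c, d <- (phi i a : k) *: b) antipode c * d
     = \cop (a, b <- L) \cop (c, d <- b) (phi i a : k) *: (antipode c * d).
    apply: eq_sweedler => a b.
    rewrite (linZ (f := fun z => \cop (c, d <- z) antipode c * d)); last by lin.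
    by rewrite (linear_sweedler (f := fun z => (phi i a : k) *: z)) //; lin.
  (* Coassociativity moves the inner coproduct onto the left legs. What remains is a combination of
     the right legs v_j with coefficients in H on the left, which is where the ideal property
     enters. *)
  rewrite -(cop_coassoc (T := fun a c d => (phi i a : k) *: (antipode c * d))); [|lin..].
  rewrite /sweedler LE tensor_lift_bigsum; last by lin.
  apply: Psum => j; rewrite -/(sweedler _ _).
  have -> : \cop (a, b <- u j) (phi i a : k) *: (antipode b * v j) =
            (\cop (a, b <- u j) (phi i a : k) *: antipode b) * v j.
    rewrite (linear_sweedler (f := fun z => z * v j)); last by lin.
    by apply: eq_sweedler => a b; rewrite scalerAl.
  exact/PM/Pv.
have -> : (1 : H) = \sum_i (counit (u i) : k) *: ((counit (v i) : k) *: 1).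
  rewrite -[LHS]scale1r -L1 -[in LHS](cop_counitl L (f := counit)); last by lin.
  rewrite (linear_sweedler (f := fun z : k^o => (z : k) *: (1 : H))); last by lin.
  rewrite /sweedler LE tensor_lift_bigsum; last by lin.
  by apply: eq_bigr => i _; rewrite scalerA.
by apply: Psum => i; apply: PZ.
Qed.

(** Mirror image of [integral_right_legs]: the elements f(L_2) L_1 form a right ideal by
    [integral_moveR], and counit(u) 1 = u_1 S(u_2) for the left legs u. *)
Lemma integral_left_legs : exists2 la : H -> k^o, linear la &
  \cop (u, v <- L) (la v : k) *: u = 1.
Proof.
pose P y := exists2 f : H -> k^o, linear f & \cop (u, v <- L) (f v : k) *: u = y.
have PD x y : P x -> P y -> P (x + y).
  move=> [f lf <-] [g lg <-]; exists (fun z => f z + g z); first by lin.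
  by rewrite -sweedlerD; apply: eq_sweedler => u v; rewrite scalerDl.
have P0 : P 0.
  exists (fun=> 0); first by move=> a x y; rewrite scaler0 addr0.
  by apply: sweedler_eq0 => u v; rewrite scale0r.
have Psum n (x : 'I_n -> H) : (forall i, P (x i)) -> P (\sum_i x i).
  by move=> Px; elim/big_ind: _.
have PM a x : P x -> P (x * a).
  move=> [f lf <-]; exists (fun z => f (z * antipode a)); first by lin.
  rewrite -(integral_moveR Lr (F := fun u v => (f v : k) *: u)); last by lin.
  rewrite (linear_sweedler (f := fun z => z * a)); last by lin.
  by apply: eq_sweedler => u v; rewrite scalerAl.
have PZ c x : P x -> P (c *: x) by rewrite -mulr_algr; apply: PM.
have [n [u [v [LE _ [phi dphi]]]]] := tensor_dual_rep (comul L).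
have lphi i := dphi.1 i.
have uE i : \cop (a, b <- L) (phi i b : k) *: a = u i.
  rewrite /sweedler LE tensor_lift_bigsum; last by lin.
  exact: dual_familyE dphi.
have Pu i : P (u i) by exists (phi i).
have P1 i : P ((counit (u i) : k) *: 1).
  have <- : \cop (a, b <- u i) a * antipode b = (counit (u i) : k) *: 1.
    exact: (cop_antipoder (f := id)).
  rewrite -uE (linear_sweedler (f := fun z => \cop (a, b <- z) a * antipode b)); last by lin.
  have -> : \cop (a, b <- L) \cop (c, d <- (phi i b : k) *: a) c * antipode d
     = \cop (a, b <- L) \cop (c, d <- a) (phi i b : k) *: (c * antipode d).
    apply: eq_sweedler => a b.
    rewrite (linZ (f := fun z => \cop (c, d <- z) c * antipode d)); last by lin.
    by rewrite (linear_sweedler (f := fun z => (phi i b : k) *: z)) //; lin.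
  rewrite (cop_coassoc (T := fun c d b => (phi i b : k) *: (c * antipode d))); [|lin..].
  rewrite /sweedler LE tensor_lift_bigsum; last by lin.
  apply: Psum => j; rewrite -/(sweedler _ _).
  have -> : \cop (a, b <- v j) (phi i b : k) *: (u j * antipode a) =
            u j * (\cop (a, b <- v j) (phi i b : k) *: antipode a).
    rewrite (linear_sweedler (f := fun z => u j * z)); last by lin.
    by apply: eq_sweedler => a b; rewrite scalerAr.
  exact/PM/Pu.
have -> : (1 : H) = \sum_i (counit (v i) : k) *: ((counit (u i) : k) *: 1).
  rewrite -[LHS]scale1r -L1 -[in LHS](cop_counitl L (f := counit)); last by lin.
  rewrite (linear_sweedler (f := fun z : k^o => (z : k) *: (1 : H))); last by lin.
  rewrite /sweedler LE tensor_lift_bigsum; last by lin.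
  by apply: eq_bigr => i _; rewrite scalerA mulrC.
by apply: Psum => i; apply: PZ.
Qed.

(* Let la be such that la(L_1) L_2 = 1.  If psi(L_2) L_1 = 1 then
   m(x) = psi(L_2 S(x)) m(L_1) for every linear m; take m(x) = la(x_1) x_2 - la(x) 1. *)
Lemma haar_functional : exists la : H -> k^o,
  [/\ linear la, exists x, la x != 0 &
      forall x, \cop (u, v <- x) (la u : k) *: v = (la x : k) *: 1].
Proof.
have [la lla laE] := integral_right_legs; have [psi lpsi psiE] := integral_left_legs.
exists la; split=> // [|x].
  apply: contrapT => la0; have /eqP := laE; rewrite eq_sym => /eqP.
  rewrite sweedler_eq0 => [/eqP|u v]; first by rewrite oner_eq0.
  suff -> : la u = 0 by rewrite scale0r.
  by apply/eqP/negP => /negP ?; apply: la0; exists u.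
pose m a := \cop (u, v <- a) (la u : k) *: v - (la a : k) *: 1.
have lm : linear m by rewrite /m; lin.
suff: m x = 0 by move/eqP; rewrite subr_eq0 => /eqP.
have -> : m x = \cop (u, v <- L) (psi (v * antipode x) : k) *: m u.
  rewrite -(integral_moveR Lr (F := fun u v => (psi v : k) *: m u)); last by lin.
  rewrite -[x in LHS]mul1r -psiE.
  rewrite (linear_sweedler (f := fun z => m (z * x))); last by lin.
  by apply: eq_sweedler => u v; rewrite -scalerAl (linZ lm).
set y := antipode x.
transitivity (\cop (u, v <- L) (\cop (a, b <- u) (psi (v * y) : k) *: ((la a : k) *: b)
   - (la u : k) *: ((psi (v * y) : k) *: 1))).
  apply: eq_sweedler => u v; rewrite /m scalerBr; congr (_ - _); last first.
    by rewrite !scalerA mulrC.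
  by rewrite (linear_sweedler (f := fun z => (psi (v * y) : k) *: z)) //; lin.
rewrite sweedlerB.
apply/eqP; rewrite subr_eq0; apply/eqP.
(* Both sums equal psi(y) 1. In the first, la(L_1) L_2 ⊗ L_3 is the coproduct of la(L_1) L_2 = 1; in
   the second, la(L_1) L_2 = 1 is substituted inside psi. *)
have -> : \cop (u, v <- L) \cop (a, b <- u) (psi (v * y) : k) *: ((la a : k) *: b)
  = (psi y : k) *: (1 : H).
  rewrite (cop_coassoc (T := fun a b v => (psi (v * y) : k) *: ((la a : k) *: b))); [|lin..].
  transitivity (\cop (u, v <- \cop (a, b <- L) (la a : k) *: b) (psi (v * y) : k) *: u).
    rewrite (linear_sweedler (f := fun z => \cop (u, v <- z) (psi (v * y) : k) *: u)); last by lin.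
    apply: eq_sweedler => a b.
    rewrite (linZ (f := fun z => \cop (u, v <- z) (psi (v * y) : k) *: u)); last by lin.
    rewrite (linear_sweedler (f := fun z => (la a : k) *: z)); last by lin.
    by apply: eq_sweedler => u v; rewrite !scalerA mulrC.
  by rewrite laE cop1 ?mul1r //; lin.
have -> : psi y = psi ((\cop (u, v <- L) (la u : k) *: v) * y) by rewrite laE mul1r.
rewrite (linear_sweedler (f := fun z => (psi (z * y) : k) *: (1 : H))); last by lin.
apply: eq_sweedler => u v; rewrite scalerA; congr (_ *: _).
by rewrite -scalerAl (linZ lpsi).
Qed.

End Haar.

(** * Nondegeneracy of invariant functionals *)

Section Nondegenerate.
Context (k : fieldType) (H : hopfAlgType k) (la : H -> k^o).
Hypotheses (lla : linear la)
  (la_inv : forall x, \cop (u, v <- x) (la u : k) *: v = (la x : k) *: 1).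

(** Expand the left side to la(x_1 y_1) x_2 y_2 S(y_3) and apply invariance to the product x y_1. *)
Lemma haar_move x y :
  \cop (u, v <- x) (la (u * y) : k) *: v = \cop (u, v <- y) (la (x * u) : k) *: antipode v.
Proof.
transitivity (\cop (u, v <- x) \cop (y1, y2 <- y) \cop (a, b <- y1)
    (la (u * a) : k) *: (v * (b * antipode y2))).
  apply: eq_sweedler => u v.
  rewrite (cop_id_id_S y (F := fun s t => (la (u * s) : k) *: (v * t))); last by lin.
  by rewrite mulr1.
rewrite exchange_sweedler; apply: eq_sweedler => u v.
rewrite -[antipode v]mul1r scalerAl -la_inv copM; last by lin.
rewrite (linear_sweedler (f := fun z => z * antipode v)); last by lin.
apply: eq_sweedler => a b.
rewrite (linear_sweedler (f := fun z => z * antipode v)); last by lin.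
by apply: eq_sweedler => c d; rewrite -scalerAl mul1r mulrA.
Qed.

(** By [haar_move], la(a_1 z) a_2 = la(a z_1) S(z_2) = 0. Independent right legs of the coproduct of
    a then give la(u_i z) = 0 for each left leg u_i, and so la(y) a = la(a_1 S(a_2) y) a_3 = 0. *)
Lemma haar_nondegenerate a : (exists x, la x != 0) ->
  (forall y, la (a * y) = 0) -> a = 0.
Proof.
move=> [y lay] la0.
have [n [u [v [aE _ [psi dpsi]]]]] := tensor_dual_rep (comul a).
have lpsi i := dpsi.1 i.
have lau i z : la (u i * z) = 0.
  have := haar_move a z.
  have -> : \cop (s, t <- z) (la (a * s) : k) *: antipode t = 0.
    by apply: sweedler_eq0 => s t; rewrite la0 scale0r.
  move/(congr1 (psi i)); rewrite (lin0 (lpsi i)) linear_sweedler //.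
  rewrite /sweedler aE tensor_lift_bigsum; last by lin.
  move=> <-; rewrite -(dual_familyE (fun j => la (u j * z)) i dpsi).
  by apply: eq_bigr => j _; rewrite (linZ (lpsi i)) /GRing.scale /= mulrC.
have : (la y : k) *: a = 0.
  transitivity (\cop (s, t <- a) \cop (b, c <- t) (la (s * antipode b * y) : k) *: c).
    rewrite (cop_id_S_id_l a (F := fun s t => (la (s * y) : k) *: t)) ?mul1r //; lin.
  rewrite /sweedler aE tensor_lift_bigsum; last by lin.
  rewrite big1 // => i _; apply: sweedler_eq0 => b c.
  by rewrite -mulrA lau scale0r.
by move/eqP; rewrite scaler_eq0 (negPf lay) => /eqP.
Qed.

End Nondegenerate.

(** * Commuting Hopf subalgebras and their products *)

Section SubHopf.
Context (k : fieldType) (H : hopfAlgType k).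
Implicit Types (A B C D : hopfSub H) (x y a b h : H).

Lemma sweedler_ind_sub A (W : lmodType k) (b : H -> H -> W) (P : W -> Prop) x :
  bilin b -> P 0 -> (forall w w', P w -> P w' -> P (w + w')) ->
  (forall u v, u \in A -> v \in A -> P (b u v)) -> x \in A -> P (sweedler x b).
Proof.
move=> bb P0 PD Pb /hopfSub_comul[s /allP sA xE].
rewrite /sweedler xE tensor_lift_sum // big_seq; elim/big_ind: _ => // p /sA.
by case/andP; exact: Pb.
Qed.

Lemma sweedler_mem A B (b : H -> H -> H) x : bilin b ->
  (forall u v, u \in A -> v \in A -> b u v \in B) -> x \in A -> sweedler x b \in B.
Proof.
move=> bb bB; apply: (@sweedler_ind_sub A H b (fun y => y \in B)) => //.
  exact: rpred0.
by move=> y z; exact: rpredD.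
Qed.

Lemma eq_sweedler_sub A (W : lmodType k) (b b' : H -> H -> W) x :
  bilin b -> bilin b' -> (forall u v, u \in A -> v \in A -> b u v = b' u v) ->
  x \in A -> sweedler x b = sweedler x b'.
Proof.
move=> bb bb' bE xA; apply/eqP; rewrite -subr_eq0 -sweedlerB; apply/eqP.
apply: (@sweedler_ind_sub A W _ (fun w => w = 0)) xA => //; first by lin.
  by move=> ? ? -> ->; rewrite addr0.
by move=> u v uA vA; rewrite bE ?subrr.
Qed.

Definition trivial_cap A B := forall x, x \in A -> x \in B -> exists c : k, x = c%:A.

Lemma trivial_capC A B : trivial_cap A B -> trivial_cap B A.
Proof. by move=> AB x xB xA; exact: AB. Qed.

Lemma normal_adl A h a : normal_hopfSub A -> a \in A ->
  \cop (x, y <- h) (x * a * antipode y) \in A.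
Proof. by move=> nA aA; case: (nA h a aA). Qed.

Lemma normal_adr A h a : normal_hopfSub A -> a \in A ->
  \cop (x, y <- h) (antipode x * a * y) \in A.
Proof. by move=> nA aA; case: (nA h a aA). Qed.

(* The Hopf commutator a_1 b_1 S(a_2) S(b_2) lies in both factors. *)
Lemma normal_commute A B : normal_hopfSub A -> normal_hopfSub B -> trivial_cap A B ->
  forall a b, a \in A -> b \in B -> a * b = b * a.
Proof.
move=> nA nB AB a b aA bB.
pose C a b := \cop (u, v <- a) \cop (s, t <- b) (u * s * antipode v * antipode t).
have lC1 y : linear (C^~ y) by rewrite /C; lin.
have lC2 x : linear (C x) by rewrite /C; lin.
have CE x y : x \in A -> y \in B -> C x y = ((counit x : k) * counit y)%:A.
  move=> xA yB.
  have [||c cE] := AB (C x y).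
  - apply: (sweedler_mem (A := A)) => //; first by lin.
    move=> u v uA vA.
    have -> : \cop (s, t <- y) (u * s * antipode v * antipode t) =
              u * \cop (s, t <- y) (s * antipode v * antipode t).
      rewrite (linear_sweedler (f := fun z => u * z)); last by lin.
      by apply: eq_sweedler => s t; rewrite !mulrA.
    by apply: rpredM => //; apply: normal_adl => //; exact: hopfSub_antipode.
  - rewrite /C exchange_sweedler; apply: (sweedler_mem (A := B)) => //; first by lin.
    move=> s t sB tB.
    have -> : \cop (u, v <- x) (u * s * antipode v * antipode t) =
              (\cop (u, v <- x) (u * s * antipode v)) * antipode t.
      by rewrite (linear_sweedler (f := fun z => z * antipode t)); last by lin.
    by apply: rpredM; [exact: normal_adl|exact: hopfSub_antipode].
  (* The scalar is recovered by taking the counit of the commutator. *)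
  rewrite cE; congr (_ *: _).
  have := congr1 counit cE; rewrite (linZ (@counit_linear _ _)) counit1.
  rewrite [c *: _]mulr1 => <-.
  rewrite /C (linear_sweedler _ _ (@counit_linear _ _)).
  transitivity (\cop (u, v <- x) (counit u : k) *: ((counit v * counit y : k) : k^o)); last first.
    by rewrite (cop_counitl x (f := fun v => (counit v * counit y : k) : k^o)) //; lin.
  apply: (@eq_sweedler k H k^o) => u v; rewrite (linear_sweedler _ _ (@counit_linear _ _)).
  transitivity (\cop (s, t <- y) 
    (counit s : k) *: ((counit u * counit v * counit t : k) : k^o)); last first.
    rewrite (cop_counitl y (f := fun t => (counit u * counit v * counit t : k) : k^o)) //;
      last by lin.
    by rewrite -mulrA.
  apply: (@eq_sweedler k H k^o) => s t; rewrite !counitM !counit_antipode /GRing.scale /=.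
  by rewrite [counit u * counit s]mulrC -!mulrA.
(* Cancelling antipodes gives a b = C(a_1, b_1) b_2 a_2, and [CE] reduces the right side to b a. *)
transitivity (\cop (u, v <- a) \cop (s, t <- b) (C u s * (t * v))); last first.
  transitivity (\cop (u, v <- a) (counit u : k) *: (b * v)); last first.
    by rewrite (cop_counitl a (f := fun v => b * v)) //; lin.
  apply: (eq_sweedler_sub (A := A)) => //; [by lin| by lin |].
  move=> u v uA vA.
  transitivity (\cop (s, t <- b) (counit s : k) *: ((counit u : k) *: (t * v))); last first.
    by rewrite (cop_counitl b (f := fun t => (counit u : k) *: (t * v))) //; lin.
  apply: (eq_sweedler_sub (A := B)) => //; [by lin| by lin |].
  by move=> s t sB tB; rewrite CE // -scalerAl mul1r scalerA mulrC.
transitivity (\cop (u, v <- a) \cop (p, q <- u) (p * b * (antipode q * v))).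
  by rewrite (cop_id_S_id_r a (F := fun p z => p * b * z)) ?mulr1 //; lin.
apply: eq_sweedler => u v.
transitivity (\cop (p, q <- u) \cop (s, t <- b) \cop (c, d <- s)
    (p * c * antipode q * (antipode d * t) * v)).
  apply: eq_sweedler => p q.
  rewrite (cop_id_S_id_r b (F := fun c z => p * c * antipode q * z * v)); last by lin.
  by rewrite mulr1 !mulrA.
rewrite exchange_sweedler; apply: eq_sweedler => s t.
rewrite /C (linear_sweedler (f := fun z => z * (t * v))); last by lin.
apply: eq_sweedler => p q.
rewrite (linear_sweedler (f := fun z => z * (t * v))); last by lin.
by apply: eq_sweedler => c d; rewrite !mulrA.
Qed.

Definition in_tensor (A : {pred H}) (t : tensor H H) :=
  exists2 s : seq (H * H), all (fun p => (p.1 \in A) && (p.2 \in A)) s &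
    t = \sum_(p <- s) p.1 ⊗ p.2.

Lemma in_tensorD (A : {pred H}) s t :
  in_tensor A s -> in_tensor A t -> in_tensor A (s + t).
Proof.
move=> [r rA ->] [r' r'A ->]; exists (r ++ r'); first by rewrite all_cat rA r'A.
by rewrite big_cat.
Qed.

Lemma in_tensor_tens (A : {pred H}) u v : u \in A -> v \in A -> in_tensor A (u ⊗ v).
Proof. by move=> uA vA; exists [:: (u, v)]; rewrite ?big_seq1 //= uA vA. Qed.

Section Product.
Context (A B : hopfSub H).

Definition prod_sub x := exists2 s : seq (H * H),
  all (fun p => (p.1 \in A) && (p.2 \in B)) s & x = \sum_(p <- s) p.1 * p.2.

Lemma prod_sub_ind (P : H -> Prop) : P 0 ->
  (forall x y, P x -> P y -> P (x + y)) ->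
  (forall a b, a \in A -> b \in B -> P (a * b)) -> forall x, prod_sub x -> P x.
Proof.
move=> P0 PD PM x [s /allP sAB ->]; rewrite big_seq; elim/big_ind: _ => // p /sAB.
by case/andP; exact: PM.
Qed.

Lemma prod_subM a b : a \in A -> b \in B -> prod_sub (a * b).
Proof. by move=> aA bB; exists [:: (a, b)]; rewrite ?big_seq1 //= aA bB. Qed.

Lemma prod_sub0 : prod_sub 0.
Proof. by exists [::]; rewrite ?big_nil. Qed.

Lemma prod_subD x y : prod_sub x -> prod_sub y -> prod_sub (x + y).
Proof.
move=> [s sA ->] [t tA ->]; exists (s ++ t); first by rewrite all_cat sA tA.
by rewrite big_cat.
Qed.

Lemma prod_subZ c x : prod_sub x -> prod_sub (c *: x).
Proof.
move: x; apply: prod_sub_ind; first by rewrite scaler0; exact: prod_sub0.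
  by move=> x y xP yP; rewrite scalerDr; exact: prod_subD.
by move=> a b aA bB; rewrite scalerAl; apply: prod_subM => //; exact: rpredZ.
Qed.

Hypothesis AB : forall a b, a \in A -> b \in B -> a * b = b * a.

Lemma prod_sub_mul x y : prod_sub x -> prod_sub y -> prod_sub (x * y).
Proof.
move=> xP yP; move: x xP; apply: prod_sub_ind; first by rewrite mul0r; exact: prod_sub0.
  by move=> x z xP zP; rewrite mulrDl; exact: prod_subD.
move=> a b aA bB; move: y yP; apply: prod_sub_ind; first by rewrite mulr0; exact: prod_sub0.
  by move=> x z xP zP; rewrite mulrDr; exact: prod_subD.
move=> c d cA dB; rewrite mulrA -[a * b * c]mulrA -(AB cA bB) mulrA -mulrA.
by apply: prod_subM; exact: rpredM.
Qed.

Definition prod_pred : {pred H} := [pred x | `[< prod_sub x >]].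

Lemma prod_predP x : reflect (prod_sub x) (x \in prod_pred).
Proof. exact: asboolP. Qed.

Fact prod_subalg : GRing.subalg_closed prod_pred.
Proof.
split.
- by apply/prod_predP; rewrite -[1]mulr1; apply: prod_subM; exact: rpred1.
- move=> c x y /prod_predP xP /prod_predP yP; apply/prod_predP.
  by apply: prod_subD => //; exact: prod_subZ.
- by move=> x y /prod_predP xP /prod_predP yP; apply/prod_predP; exact: prod_sub_mul.
Qed.

Fact prod_comul x : x \in prod_pred -> in_tensor prod_pred (comul x).
Proof.
move/prod_predP; move: x; apply: prod_sub_ind.
- by rewrite (lin0 (@comul_linear _ H)); exists [::]; rewrite ?big_nil.
- by move=> x y xP yP; rewrite (linD (@comul_linear _ H)); exact: in_tensorD.
move=> a b /hopfSub_comul[s /allP sA aE] /hopfSub_comul[t /allP tB bE].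
rewrite comulM aE bE (lin_sum (@tensor_mul_linearl _ _ _ _)) big_seq.
elim/big_ind: _ => [||p /sA/andP[p1 p2]].
- by exists [::]; rewrite ?big_nil.
- by move=> *; exact: in_tensorD.
rewrite (lin_sum (@tensor_mul_linearr _ _ _ _)) big_seq.
elim/big_ind: _ => [||q /tB/andP[q1 q2]].
- by exists [::]; rewrite ?big_nil.
- by move=> *; exact: in_tensorD.
by rewrite tensor_mul_tens; apply: in_tensor_tens; apply/prod_predP; exact: prod_subM.
Qed.

Fact prod_antipode x : x \in prod_pred -> antipode x \in prod_pred.
Proof.
move/prod_predP => xP; apply/prod_predP; move: x xP; apply: prod_sub_ind.
- by rewrite (lin0 (@antipode_linear _ H)); exact: prod_sub0.
- by move=> x y xP yP; rewrite (linD (@antipode_linear _ H)); exact: prod_subD.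
move=> a b aA bB; rewrite AB // antipodeM.
by apply: prod_subM; exact: hopfSub_antipode.
Qed.

Definition prod_hopfSub := HopfSub prod_subalg prod_comul prod_antipode.

(** Adjoint actions distribute over products: h_1 a b S(h_2) = (h_1 a S(h_2)) (h_3 b S(h_4)), and
    likewise S(h_1) a b h_2 = (S(h_1) a h_2) (S(h_3) b h_4). *)
Lemma prod_hopfSub_normal : normal_hopfSub A -> normal_hopfSub B ->
  normal_hopfSub prod_hopfSub.
Proof.
move=> nA nB h x /prod_predP xP.
suff : prod_sub (\cop (u, v <- h) (u * x * antipode v)) /\
       prod_sub (\cop (u, v <- h) (antipode u * x * v)).
  by case=> ? ?; split; apply/prod_predP.
have cop_prod (y : H) (F : H -> H -> H) (G : H -> H -> H) : bilin F -> bilin G ->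
  (forall z, sweedler z F \in A) -> (forall z, sweedler z G \in B) ->
  prod_sub (\cop (u, v <- y) (sweedler u F * sweedler v G)).
  move=> bF bG FA GB; rewrite /sweedler; have [s ->] := tensor_sumP (comul y).
  rewrite tensor_lift_sum; last by lin.
  elim/big_ind: _; [exact: prod_sub0|exact: prod_subD|].
  by move=> p _; apply: prod_subM; [exact: FA|exact: GB].
move: x xP; apply: prod_sub_ind.
- split; rewrite sweedler_eq0; try exact: prod_sub0.
    by move=> u v; rewrite mulr0 mul0r.
  by move=> u v; rewrite mulr0 mul0r.
- move=> x y [x1 x2] [y1 y2]; split.
    have -> : \cop (u, v <- h) (u * (x + y) * antipode v) =
      \cop (u, v <- h) (u * x * antipode v) + \cop (u, v <- h) (u * y * antipode v).
      by rewrite -sweedlerD; apply: eq_sweedler => u v; rewrite mulrDr mulrDl.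
    exact: prod_subD.
  have -> : \cop (u, v <- h) (antipode u * (x + y) * v) =
    \cop (u, v <- h) (antipode u * x * v) + \cop (u, v <- h) (antipode u * y * v).
    by rewrite -sweedlerD; apply: eq_sweedler => u v; rewrite mulrDr mulrDl.
  exact: prod_subD.
move=> a b aA bB; split.
  have -> : \cop (u, v <- h) (u * (a * b) * antipode v) =
    \cop (p, q <- h) ((\cop (s, t <- p) (s * a * antipode t)) *
                      \cop (c, d <- q) (c * b * antipode d)).
    transitivity (\cop (p, q <- h) \cop (s, t <- p) \cop (c, d <- q)
        (s * a * (antipode t * c * b * antipode d))).
      rewrite (cop_coassoc (T := fun s t q => \cop (c, d <- q)
        (s * a * (antipode t * c * b * antipode d)))); [|lin..].
      apply: eq_sweedler => s w.
      rewrite (cop_S_id_id w (F := fun y d => s * a * (y * b * antipode d))); last by lin.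
      by rewrite mul1r !mulrA.
    apply: eq_sweedler => p q.
    rewrite (linear_sweedler (f := fun z => z * _)); last by lin.
    apply: eq_sweedler => s t; rewrite (linear_sweedler (f := fun z => _ * z)); last by lin.
    by apply: eq_sweedler => c d; rewrite !mulrA.
  by apply: cop_prod => [||z|z]; [lin|lin|exact: normal_adl|exact: normal_adl].
have -> : \cop (u, v <- h) (antipode u * (a * b) * v) =
  \cop (p, q <- h) ((\cop (s, t <- p) (antipode s * a * t)) *
                    \cop (c, d <- q) (antipode c * b * d)).
  transitivity (\cop (p, q <- h) \cop (s, t <- p) \cop (c, d <- q)
      (antipode s * a * (t * antipode c * b * d))).
    rewrite (cop_coassoc (T := fun s t q => \cop (c, d <- q)
      (antipode s * a * (t * antipode c * b * d)))); [|lin..].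
    apply: eq_sweedler => s w.
    rewrite (cop_id_S_id_l w (F := fun y d => antipode s * a * (y * b * d))); last by lin.
    by rewrite mul1r !mulrA.
  apply: eq_sweedler => p q.
  rewrite (linear_sweedler (f := fun z => z * _)); last by lin.
  apply: eq_sweedler => s t; rewrite (linear_sweedler (f := fun z => _ * z)); last by lin.
  by apply: eq_sweedler => c d; rewrite !mulrA.
by apply: cop_prod => [||z|z]; [lin|lin|exact: normal_adr|exact: normal_adr].
Qed.

End Product.
End SubHopf.

(** * Integrals of Hopf subalgebras and multiplication by them *)

Section SubIntegral.
Context (k : fieldType) (H : hopfAlgType k).
Implicit Types (A B C K : hopfSub H) (x y a b p q : H).

Lemma hval_sweedler A (W : lmodType k) (F : H -> H -> W) (x : hopfSub_of A) :
  bilin F -> sweedler (hval x) F = \cop (u, v <- x) F (hval u) (hval v).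
Proof. by move=> bF; rewrite /sweedler -hval_comul tensor_lift_map. Qed.

(** Stated with an element of H rather than of [hopfSub_of A], as is [invariant_on] below with
    functionals on H, so that data of different subalgebras can be multiplied and compared. *)
Definition sub_integral A p := [/\ p \in A, counit p = 1,
  forall a, a \in A -> a * p = (counit a : k) *: p &
  forall a, a \in A -> p * a = (counit a : k) *: p].

Lemma semisimple_sub_integral A : semisimple_alg (hopfSub_of A) ->
  exists p, sub_integral A p.
Proof.
case/semisimple_integral => -[p pA] [p1 pl pr]; exists p; split=> // a aA.
  by have /(congr1 (@hval _ _ A)) := pl (HopfSubOf aA).
by have /(congr1 (@hval _ _ A)) := pr (HopfSubOf aA).
Qed.

Definition invariant_on A (la : H -> k^o) :=
  forall x, x \in A -> \cop (u, v <- x) (la u : k) *: v = (la x : k) *: 1.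

Lemma sub_invariant A (la : H -> k^o) : linear la -> invariant_on A la ->
  forall x : hopfSub_of A, \cop (u, v <- x) (la (hval u) : k) *: v = (la (hval x) : k) *: 1.
Proof.
move=> lla inv [x xA]; apply: hval_inj.
rewrite (linear_sweedler _ _ (@hval_linear _ _ A)).
rewrite -(hval_sweedler (F := fun u v => (la u : k) *: v)); last by lin.
exact: inv.
Qed.

(** The functional obtained on [hopfSub_of A] is extended to H along a linear retraction. *)
Lemma sub_haar A p : sub_integral A p -> exists la : H -> k^o,
  [/\ linear la, exists2 x, x \in A & la x != 0 & invariant_on A la].
Proof.
case=> pA p1 pl pr.
have [|||la [lla [x lax] inv]] := @haar_functional _ (hopfSub_of A) (HopfSubOf pA).
- exact: p1.
- by case=> a aA; apply: hval_inj; exact: pl.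
- by case=> a aA; apply: hval_inj; exact: pr.
have [r lr rK] := linear_retraction (@hval_linear _ _ A) (@hval_inj _ _ A).
exists (fun y => la (r y)); split; first exact: (linear_compf lla lr).
  by exists (hval x); rewrite ?rK //; case: (x).
move=> y yA; rewrite -[y]/(hval (HopfSubOf yA)).
have llr : linear (fun y => la (r y)) by exact: (linear_compf lla lr).
rewrite (hval_sweedler (F := fun u v => (la (r u) : k) *: v)); last by lin.
have /(congr1 (@hval _ _ A)) := inv (HopfSubOf yA).
rewrite (linear_sweedler _ _ (@hval_linear _ _ A)) rK => E.
rewrite -[RHS]E; apply: eq_sweedler => u v; by rewrite rK.
Qed.

Lemma sub_haar_move A (la : H -> k^o) x y : linear la -> invariant_on A la ->
  x \in A -> y \in A ->
  \cop (u, v <- x) (la (u * y) : k) *: v = \cop (u, v <- y) (la (x * u) : k) *: antipode v.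
Proof.
move=> lla /(sub_invariant lla) inv xA yA.
have lla' : linear (fun x : hopfSub_of A => la (hval x)) by lin.
have := haar_move lla' inv (HopfSubOf xA) (HopfSubOf yA).
move/(congr1 (@hval _ _ A)); rewrite !(linear_sweedler _ _ (@hval_linear _ _ A)).
rewrite -(hval_sweedler (F := fun u v => (la (u * y) : k) *: v)); last by lin.
move=> ->.
rewrite -[y in RHS]/(hval (HopfSubOf yA)) hval_sweedler; last by lin.
by apply: eq_sweedler => u v; rewrite (linZ (@hval_linear _ _ A)) hval_antipode.
Qed.

Lemma sub_haar_nondegenerate A (la : H -> k^o) a : linear la -> invariant_on A la ->
  (exists2 x, x \in A & la x != 0) -> a \in A ->
  (forall y, y \in A -> la (a * y) = 0) -> a = 0.
Proof.
move=> lla /(sub_invariant lla) inv [x xA lax] aA la0.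
have lla' : linear (fun x : hopfSub_of A => la (hval x)) by lin.
have := haar_nondegenerate lla' inv (a := HopfSubOf aA).
move=> /(_ _ _)/(congr1 (@hval _ _ A)); apply; first by exists (HopfSubOf xA).
by case=> y yA; exact: la0.
Qed.

Section Product.
Context (A B : hopfSub H) (p q : H).
Hypotheses (AB : forall a b, a \in A -> b \in B -> a * b = b * a)
  (capAB : trivial_cap A B) (qA : sub_integral A q) (pB : sub_integral B p).

Lemma prod_integral : sub_integral (prod_hopfSub AB) (q * p).
Proof.
have [qm q1 ql qr] := qA; have [pm p1 pl pr] := pB.
split; first by apply/prod_predP; exact: prod_subM.
- by rewrite counitM q1 p1 mulr1.
- move=> x /prod_predP; move: x; apply: prod_sub_ind.
  + by rewrite mul0r (lin0 (@counit_linear _ H)) scale0r.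
  + by move=> x y xE yE; rewrite mulrDl xE yE (linD (@counit_linear _ H)) scalerDl.
  move=> a b am bm; rewrite mulrA -[a * b * q]mulrA -(AB qm bm) mulrA -mulrA.
  by rewrite ql // pl // -scalerAl -scalerAr scalerA counitM.
move=> x /prod_predP; move: x; apply: prod_sub_ind.
+ by rewrite mulr0 (lin0 (@counit_linear _ H)) scale0r.
+ by move=> x y xE yE; rewrite mulrDr xE yE (linD (@counit_linear _ H)) scalerDl.
move=> a b am bm; rewrite mulrA -[q * p * a]mulrA -(AB am pm) mulrA -mulrA.
by rewrite qr // pr // -scalerAl -scalerAr scalerA counitM.
Qed.

(* la(a_1 p) a_2 = la(a p_1) S(p_2) lies in A \cap B = k, so that la(_ * p) is
   invariant on A. *)
Lemma mul_integral_eq0 a : a \in A -> a * p = 0 -> a = 0.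
Proof.
move=> aA ap0; have [pm p1 pl pr] := pB.
have [la [lla [x xQ lax] inv]] := sub_haar prod_integral.
have AQ y : y \in A -> y \in prod_hopfSub AB.
  by move=> yA; apply/prod_predP; rewrite -[y]mulr1; apply: prod_subM => //; exact: rpred1.
have pQ : p \in prod_hopfSub AB.
  by apply/prod_predP; rewrite -[p]mul1r; apply: prod_subM => //; exact: rpred1.
pose la' y := la (y * p).
have lla' : linear la' by rewrite /la'; lin.
apply: (sub_haar_nondegenerate (A := A) (la := la')) => //.
- move=> y yA.
  have [||c cE] := capAB (x := \cop (u, v <- y) (la' u : k) *: v).
  + by apply: (sweedler_mem (A := A)) yA; [lin|move=> *; exact: rpredZ].
  + rewrite /la' (sub_haar_move lla inv) //; last exact: AQ.
    apply: (sweedler_mem (A := B)) pm; first by lin.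
    by move=> u v uB vB; apply: rpredZ; exact: hopfSub_antipode.
  rewrite cE; congr (_ *: _); have := congr1 counit cE.
  rewrite (linZ (@counit_linear _ _)) counit1 [c *: _]mulr1 => <-.
  rewrite (linear_sweedler _ _ (@counit_linear _ _)) -(cop_counitr y lla').
  by apply: (@eq_sweedler k H k^o) => u v; rewrite (linZ (@counit_linear _ _)) [LHS]mulrC.
(* If la(b p) = 0 for all b in A, then la(p y) = 0 for all y in AB, since p absorbs the B-part of y.
   Nondegeneracy on AB gives p = 0, against counit(p) = 1. *)
- apply: contrapT => la'0.
  have p0 : p = 0.
    apply: (sub_haar_nondegenerate lla inv) => //; first by exists x.
    move=> y /prod_predP; move: y; apply: prod_sub_ind.
    + by rewrite mulr0 (lin0 lla).
    + by move=> y z yE zE; rewrite mulrDr (linD lla) yE zE addr0.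
    move=> b c bA cB; rewrite mulrA -(AB bA pm) -mulrA pr // -scalerAr (linZ lla).
    suff -> : la (b * p) = 0 by rewrite scaler0.
    by apply/eqP/negP => /negP ?; apply: la'0; exists b.
  by move/eqP: p1; rewrite p0 (lin0 (@counit_linear _ H)) eq_sym oner_eq0.
move=> y yA; rewrite /la' -mulrA (AB yA pm) mulrA ap0 mul0r; exact: lin0.
Qed.

(** Since b a p = counit(b) a p, the map x -> r(x p) is on AB the projection to A that applies the
    counit to the B-part. *)
Lemma mul_integral_retraction : exists2 r : H -> hopfSub_of A, linear r &
  forall x : hopfSub_of A, r (hval x * p) = x.
Proof.
have l : linear (fun x : hopfSub_of A => hval x * p) by lin.
apply: (linear_retraction l) => x y /eqP; rewrite -subr_eq0 -mulrBl => /eqP xy.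
apply: hval_inj; apply/eqP; rewrite -subr_eq0; apply/eqP.
by apply: mul_integral_eq0 xy; apply: rpredB; [case: (x)|case: (y)].
Qed.

End Product.
End SubIntegral.

(** * The exchange property of simple factors *)

Section Exchange.
Context (k : fieldType) (H : hopfAlgType k).
Implicit Types (A B C K L : hopfSub H) (p : H).

Lemma antipode1 : antipode (1 : H) = 1.
Proof.
rewrite -[LHS]mulr1 -(cop1 (b := fun x y : H => antipode x * y)); last by lin.
by rewrite (cop_antipodel (f := id)) // counit1 scale1r.
Qed.

(** The intersection of K and C is a normal Hopf subalgebra of K. The delicate point is its
    coproduct: for x in the intersection, a leg of comul x taken in K ⊗ K with dual functionals is
    psi(x_2) x_1 or phi(x_1) x_2, and this lies in C when computed from the coproduct of C. *)
Lemma simple_cap K C : simple_hopf (hopfSub_of K) -> normal_hopfSub C ->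
  trivial_cap K C \/ forall x, x \in K -> x \in C.
Proof.
move=> [_ sK] nC; pose P : {pred hopfSub_of K} := fun u => hval u \in C.
have Palg : GRing.subalg_closed P.
  split; first exact: rpred1.
    by move=> c x y xC yC; rewrite unfold_in /P /= rpredD ?rpredZ.
  by move=> x y xC yC; rewrite unfold_in /P /= rpredM.
have Pcomul (x : hopfSub_of K) : x \in P -> exists2 s : seq (hopfSub_of K * hopfSub_of K),
    all (fun w => (w.1 \in P) && (w.2 \in P)) s & comul x = \sum_(w <- s) w.1 ⊗ w.2.
  move=> xP; have [r lr rK] := linear_retraction (@hval_linear _ _ K) (@hval_inj _ _ K).
  have [n [u [v [xE [phi dphi] [psi dpsi]]]]] := tensor_dual_rep (comul x).
  have lphi i := dphi.1 i; have lpsi i := dpsi.1 i.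
  exists [seq (u i, v i) | i : 'I_n]; last by rewrite xE big_map big_enum.
  apply/allP => _ /mapP[i _ ->] /=; apply/andP; split; rewrite unfold_in /P.
    have -> : hval (u i) = \cop (s, t <- hval x) (psi i (r t) : k) *: s.
      rewrite hval_sweedler; last by lin.
      rewrite /sweedler xE tensor_lift_bigsum; last by lin.
      rewrite -(dual_familyE (fun j => hval (u j)) i dpsi).
      by apply: eq_bigr => j _; rewrite rK.
    apply: (sweedler_mem (A := C)) => //; last by move=> *; exact: rpredZ.
    by lin.
  have -> : hval (v i) = \cop (s, t <- hval x) (phi i (r s) : k) *: t.
    rewrite hval_sweedler; last by lin.
    rewrite /sweedler xE tensor_lift_bigsum; last by lin.
    rewrite -(dual_familyE (fun j => hval (v j)) i dphi).
    by apply: eq_bigr => j _; rewrite rK.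
  apply: (sweedler_mem (A := C)) => //; last by move=> *; exact: rpredZ.
  by lin.
have Pantipode (x : hopfSub_of K) : x \in P -> antipode x \in P.
  by move=> xP; rewrite unfold_in /P hval_antipode; exact: hopfSub_antipode.
have [|tr|all] := sK (HopfSub Palg Pcomul Pantipode).
- move=> h a aP; rewrite -!/(sweedler _ _); split.
    rewrite unfold_in /P /= (linear_sweedler _ _ (@hval_linear _ _ K)).
    have -> : \cop (u, v <- h) hval (u * a * antipode v) =
              \cop (u, v <- hval h) (u * hval a * antipode v).
      rewrite hval_sweedler; last by lin.
      by apply: eq_sweedler => u v; rewrite !hvalM hval_antipode.
    exact: normal_adl.
  rewrite unfold_in /P /= (linear_sweedler _ _ (@hval_linear _ _ K)).
  have -> : \cop (u, v <- h) hval (antipode u * a * v) =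
            \cop (u, v <- hval h) (antipode u * hval a * v).
    rewrite hval_sweedler; last by lin.
    by apply: eq_sweedler => u v; rewrite !hvalM hval_antipode.
  exact: normal_adr.
- left=> x xK xC; have [|c xE] := tr (HopfSubOf xK); first exact: xC.
  by exists c; have := congr1 (@hval _ _ K) xE.
- by right=> x xK; exact: all (HopfSubOf xK).
Qed.

Lemma simple_nontrivial K : simple_hopf (hopfSub_of K) ->
  ~ forall x, x \in K -> exists c : k, x = c%:A.
Proof.
move=> [[x xn] _] tr; have [|c xE] := tr (hval x); first by case: (x).
by apply: (xn c); apply: hval_inj.
Qed.

(* The isomorphism sends x to the unique y in L with y p = x p. *)
Lemma complements_hopf_iso B K L p : sub_integral B p ->
  (forall b x, b \in B -> x \in K -> b * x = x * b) ->
  (forall b x, b \in B -> x \in L -> b * x = x * b) ->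
  trivial_cap B K -> trivial_cap B L ->
  (exists q, sub_integral K q) -> (exists q, sub_integral L q) ->
  (forall x, x \in K -> prod_sub B L x) -> (forall x, x \in L -> prod_sub B K x) ->
  hopf_iso (hopfSub_of K) (hopfSub_of L).
Proof.
move=> pB BK BL cK cL [qK qKi] [qL qLi] KBL LBK.
have [pm p1 pl pr] := pB.
have KB x b : x \in K -> b \in B -> x * b = b * x by move=> xK bB; exact/esym/BK.
have LB x b : x \in L -> b \in B -> x * b = b * x by move=> xL bB; exact/esym/BL.
have [rK lrK rKK] := mul_integral_retraction KB (trivial_capC cK) qKi pB.
have [rL lrL rLK] := mul_integral_retraction LB (trivial_capC cL) qLi pB.
(* On BA, multiplication by p only sees the A-part, because b a p = counit(b) a p. *)
have shift A (r : H -> hopfSub_of A) x : linear r ->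
    (forall x b, x \in A -> b \in B -> x * b = b * x) ->
    (forall z : hopfSub_of A, r (hval z * p) = z) -> prod_sub B A x -> hval (r (x * p)) * p = x * p.
  move=> lr AB rE; move: x; apply: prod_sub_ind.
  - by rewrite mul0r (lin0 lr) mul0r.
  - by move=> x y xE yE; rewrite mulrDl (linD lr) /= mulrDl xE yE.
  move=> b a bB aA; rewrite -(AB _ _ aA bB) -mulrA (pl _ bB) -scalerAr (linZ lr).
  by rewrite -[a]/(hval (HopfSubOf aA)) rE -scalerAl.
pose f (x : hopfSub_of K) := rL (hval x * p).
pose g (y : hopfSub_of L) := rK (hval y * p).
have fE x : hval (f x) * p = hval x * p.
  by apply: shift => //; apply: KBL; case: (x).
have gE y : hval (g y) * p = hval y * p.
  by apply: shift => //; apply: LBK; case: (y).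
have fK : cancel f g by move=> x; rewrite /g fE rKK.
have gK : cancel g f by move=> y; rewrite /f gE rLK.
have lf : linear f by apply: (linear_compf (g := rL)) => //; lin.
have injL (x y : hopfSub_of L) : hval x * p = hval y * p -> x = y.
  by move=> xy; rewrite -[x]rLK xy rLK.
have fM : monoid_morphism f.
  split; first by apply: injL; rewrite fE.
  move=> x y; apply: injL; rewrite fE !hvalM -!mulrA fE.
  have -> : hval y * p = p * hval y by apply: KB => //; case: (y).
  by rewrite !mulrA fE.
have fcomul x : comul (f x) = tensor_map f f (comul x).
  pose h (y : hopfSub_of L) := hval y * p.
  have lh : linear h by rewrite /h; lin.
  apply: (tensor_map_inj lh lh injL injL).
  have bb : bilin (fun u v : H => (u * p) ⊗ (v * p)) by lin.
  (* Since comul(p) (p ⊗ p) = p ⊗ p, the coproducts of X p and of X agree after right multiplication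
     by p ⊗ p. With f(x) p = x p this compares the coproducts of f(x) and x. *)
  have shiftE (X : H) : \cop (u, v <- X * p) ((u * p) ⊗ (v * p)) =
      \cop (u, v <- X) ((u * p) ⊗ (v * p)).
    rewrite copM //; apply: eq_sweedler => u v.
    transitivity (\cop (y1, y2 <- p) (counit y1 : k) *: ((counit y2 : k) *: ((u * p) ⊗ (v * p)))).
      apply: (eq_sweedler_sub (A := B)) => //; [by lin|by lin|].
      by move=> s t sB tB; rewrite -!mulrA (pl _ sB) (pl _ tB) -!scalerAr tensZl tensZr.
    rewrite (cop_counitl p (f := fun z => (counit z : k) *: ((u * p) ⊗ (v * p)))); last by lin.
    by rewrite p1 scale1r.
  transitivity (\cop (u, v <- hval (f x)) ((u * p) ⊗ (v * p))).
    by rewrite hval_sweedler.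
  rewrite -shiftE fE shiftE hval_sweedler //.
  transitivity (\cop (u, v <- x) (h (f u) ⊗ h (f v))).
    by apply: eq_sweedler => u v; rewrite /h !fE.
  exact: esym (tensor_lift_map (comul x) lf lf (tensor_map_bilin lh lh)).
have fcounit x : counit (f x) = counit x.
  rewrite -[LHS]/(counit (hval (f x))) -[RHS]/(counit (hval x)).
  by have := congr1 counit (fE x); rewrite !counitM p1 !mulr1.
have fantipode x : antipode (f x) = f (antipode x).
  (* S(X p) = S(p) S(X), and p S(p) = counit(p) p = p. As p commutes with K and L, the antipodes of
     f(x) and x can thus be compared behind p. *)
  have pS X : p * antipode (X * p) = p * antipode X.
    rewrite antipodeM mulrA (pr _ (hopfSub_antipode pm)).
    by rewrite counit_antipode p1 scale1r.
  apply: injL; rewrite hval_antipode fE hval_antipode.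
  rewrite -(BL _ (antipode (hval (f x)))) //; last first.
    by apply: hopfSub_antipode; case: (f x).
  rewrite -(BK _ (antipode (hval x))) //; last first.
    by apply: hopfSub_antipode; case: (x).
  by rewrite -pS fE pS.
pose F : {lrmorphism hopfSub_of K -> hopfSub_of L} :=
  HB.pack f (GRing.isLinear.Build k _ _ _ f lf) (GRing.isMonoidMorphism.Build _ _ f fM).
by exists F; split=> //; exists g.
Qed.

(** A relation on elements, because [prod_hopfSub] depends on a proof of commutation and the same C
    has to be recognised as a product in several ways. *)
Definition is_prod B K C := forall x, x \in C <-> prod_sub B K x.

Definition normal_integral A := normal_hopfSub A /\ exists p, sub_integral A p.

Definition simple_factor A := normal_integral A /\ simple_hopf (hopfSub_of A).

Lemma normal_integral_commute A B : normal_integral A -> normal_integral B -> trivial_cap A B ->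
  forall a b, a \in A -> b \in B -> a * b = b * a.
Proof. by move=> [nA _] [nB _]; exact: normal_commute. Qed.

Lemma normal_integral_prod A B : normal_integral A -> normal_integral B -> trivial_cap A B ->
  exists2 C, normal_integral C & is_prod A B C.
Proof.
move=> gA gB cAB; have AB := normal_integral_commute gA gB cAB.
have [[nA [q qA]] [nB [p pB]]] := (gA, gB).
exists (prod_hopfSub AB); last by move=> x; split=> /prod_predP.
by split; [exact: prod_hopfSub_normal|exists (q * p); exact: prod_integral].
Qed.

Lemma prod_subl A B x : x \in A -> prod_sub A B x.
Proof. by move=> xA; rewrite -[x]mulr1; apply: prod_subM => //; exact: rpred1. Qed.

Lemma prod_subr A B x : x \in B -> prod_sub A B x.
Proof. by move=> xA; rewrite -[x]mul1r; apply: prod_subM => //; exact: rpred1. Qed.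

Lemma prod_sub_le A B C : (forall x, x \in A -> x \in C) ->
  (forall x, x \in B -> x \in C) -> forall x, prod_sub A B x -> x \in C.
Proof.
move=> AC BC; apply: prod_sub_ind; [exact: rpred0|by move=> *; exact: rpredD|].
by move=> a b aA bB; apply: rpredM; [exact: AC|exact: BC].
Qed.

(* The projection pi of BK onto K satisfies x_1 S(pi(x_2)) in B and
   S(x_1) pi(x_2) in B.  By the second, pi maps L into K \cap BL.  Unless this is K,
   pi(L) = k, and then L is contained in B by the first. *)
Lemma simple_factor_exchange_le B K L : normal_integral B -> simple_factor K -> simple_factor L ->
  trivial_cap B K -> trivial_cap B L -> (forall x, x \in L -> prod_sub B K x) ->
  forall x, x \in K -> prod_sub B L x.
Proof.
move=> gB [gK sK] [gL sL] cK cL LBK.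
have BK := normal_integral_commute gB gK cK; have BL := normal_integral_commute gB gL cL.
have KB x b : x \in K -> b \in B -> x * b = b * x by move=> xK bB; exact/esym/BK.
have [nB [p pB]] := gB; have [nK [q qK]] := gK.
have [pm p1 pl pr] := pB.
have [r lr rE] := mul_integral_retraction KB (trivial_capC cK) qK pB.
pose pi x := hval (r (x * p)).
have lpi : linear pi by rewrite /pi; lin.
have piK x : pi x \in K by rewrite /pi; case: (r _).
have piM b a : b \in B -> a \in K -> pi (b * a) = (counit b : k) *: a.
  move=> bB aK; rewrite /pi -(KB _ _ aK bB) -mulrA (pl _ bB) -scalerAr (linZ lr).
  by rewrite -[a]/(hval (HopfSubOf aK)) rE.
(* On x = b a the sum is counit(a) b; in [pi_S] below it is counit(a) S(b). *)
have S_pi x : prod_sub B K x -> \cop (u, v <- x) (u * antipode (pi v)) \in B.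
  move: x; apply: prod_sub_ind.
  - by rewrite (lin0 (f := fun x => \cop (u, v <- x) (u * antipode (pi v)))) ?rpred0; last by lin.
  - move=> x y xB yB.
    rewrite (linD (f := fun x => \cop (u, v <- x) (u * antipode (pi v)))); last by lin.
    exact: rpredD.
  move=> b a bB aK; rewrite copM; last by lin.
  suff -> : \cop (b1, b2 <- b) \cop (a1, a2 <- a) (b1 * a1 * antipode (pi (b2 * a2)))
     = (counit a : k) *: b by exact: rpredZ.
  transitivity (\cop (b1, b2 <- b) (counit b2 : k) *: ((counit a : k) *: b1)); last first.
    by rewrite (cop_counitr b (f := fun b1 => (counit a : k) *: b1)) //; lin.
  apply: (eq_sweedler_sub (A := B)) => //; [by lin|by lin|move=> b1 b2 b1B b2B].
  transitivity (\cop (a1, a2 <- a) (counit b2 : k) *: (b1 * (a1 * antipode a2))).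
    apply: (eq_sweedler_sub (A := K)) => //; [by lin|by lin|move=> a1 a2 a1K a2K].
    by rewrite piM // (linZ (@antipode_linear _ H)) -scalerAr mulrA.
  rewrite (cop_antipoder a (f := fun z => (counit b2 : k) *: (b1 * z))); last by lin.
  by rewrite mulr1 !scalerA mulrC.
have pi_S x : prod_sub B K x -> \cop (u, v <- x) (antipode u * pi v) \in B.
  move: x; apply: prod_sub_ind.
  - by rewrite (lin0 (f := fun x => \cop (u, v <- x) (antipode u * pi v))) ?rpred0; last by lin.
  - move=> x y xB yB.
    rewrite (linD (f := fun x => \cop (u, v <- x) (antipode u * pi v))); last by lin.
    exact: rpredD.
  move=> b a bB aK; rewrite copM; last by lin.
  suff -> : \cop (b1, b2 <- b) \cop (a1, a2 <- a) (antipode (b1 * a1) * pi (b2 * a2))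
     = (counit a : k) *: antipode b by apply: rpredZ; exact: hopfSub_antipode.
  transitivity (\cop (b1, b2 <- b) (counit b2 : k) *: ((counit a : k) *: antipode b1)); last first.
    by rewrite (cop_counitr b (f := fun b1 => (counit a : k) *: antipode b1)) //; lin.
  apply: (eq_sweedler_sub (A := B)) => //; [by lin|by lin|move=> b1 b2 b1B b2B].
  transitivity (\cop (a1, a2 <- a) (counit b2 : k) *: (antipode b1 * (antipode a1 * a2))).
    apply: (eq_sweedler_sub (A := K)) => //; [by lin|by lin|move=> a1 a2 a1K a2K].
    rewrite piM // -scalerAr antipodeM mulrA.
    by rewrite (KB _ _ (hopfSub_antipode a1K) (hopfSub_antipode b1B)).
  rewrite (cop_antipodel a (f := fun z => (counit b2 : k) *: (antipode b1 * z))); last by lin.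
  by rewrite mulr1 !scalerA mulrC.
(* Here pi(x) = x_1 (S(x_2) pi(x_3)), with x_1 in L and the bracket in B. *)
have piL x : x \in L -> prod_sub B L (pi x).
  move=> xL; rewrite -[pi x]mul1r.
  rewrite -(cop_id_S_id_l x (F := fun y z => y * pi z)); last by lin.
  apply: (sweedler_ind_sub (A := L) (P := prod_sub B L)) xL; first by lin.
  - exact: prod_sub0.
  - exact: prod_subD.
  move=> u w uL wL.
  have -> : \cop (v, z <- w) (u * antipode v * pi z) =
            (\cop (v, z <- w) (antipode v * pi z)) * u.
    rewrite BL //; last exact/pi_S/LBK.
    rewrite (linear_sweedler (f := fun z => u * z)); last by lin.
    by apply: eq_sweedler => v z; rewrite mulrA.
  by apply: prod_subM => //; exact/pi_S/LBK.
have [C gC CE] := normal_integral_prod gB gL cL.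
have [KC|KC] := simple_cap sK gC.1; last by move=> x /KC /CE.
case: (simple_nontrivial sL) => x xL; apply: (cL) => //.
have eps_pi z : prod_sub B K z -> counit (pi z) = counit z.
  move: z; apply: prod_sub_ind.
  - by rewrite (lin0 lpi).
  - by move=> y z yE zE; rewrite (linD lpi) !(linD (@counit_linear _ H)) yE zE.
  by move=> b a bB aK; rewrite piM // (linZ (@counit_linear _ H)) counitM.
have pi_eps z : z \in L -> pi z = (counit z : k) *: 1.
  move=> zL; have [|c cE] := KC (pi z) (piK z); first exact/CE/piL.
  have := congr1 counit cE; rewrite (eps_pi _ (LBK _ zL)) => ->.
  by rewrite (linZ (@counit_linear _ H)) counit1 [c *: _]mulr1.
(* As pi is the counit on L, x = x_1 S(pi(x_2)), which lies in B by [S_pi]. *)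
have <- : \cop (u, v <- x) (u * antipode (pi v)) = x; last exact/S_pi/LBK.
rewrite -[RHS](cop_counitr x (f := id)) //.
apply: (eq_sweedler_sub (A := L)) => //; [by lin|by lin|move=> u v uL vL].
by rewrite pi_eps // (linZ (@antipode_linear _ H)) antipode1 -scalerAr mulr1.
Qed.

Lemma simple_factor_exchange B K L C : normal_integral B -> simple_factor K -> simple_factor L ->
  trivial_cap B K -> trivial_cap B L -> is_prod B K C ->
  (forall x, x \in L -> x \in C) ->
  hopf_iso (hopfSub_of K) (hopfSub_of L) /\ is_prod B L C.
Proof.
move=> gB aK aL cK cL CE LC.
have LBK x : x \in L -> prod_sub B K x by move/LC/CE.
have KBL := simple_factor_exchange_le gB aK aL cK cL LBK.
have [[gK _] [gL _]] := (aK, aL).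
have BK := normal_integral_commute gB gK cK; have BL := normal_integral_commute gB gL cL.
split.
  have [_ [p pB]] := gB.
  exact: (complements_hopf_iso pB BK BL cK cL gK.2 gL.2 KBL LBK).
move=> x; split.
  move/CE; move: x; apply: prod_sub_ind; [exact: prod_sub0|exact: prod_subD|].
  by move=> b a bB aK'; apply: prod_sub_mul => //; [exact: prod_subl|exact: KBL].
by apply: prod_sub_le => [y yB|y yL]; [apply/CE; exact: prod_subl|exact: LC].
Qed.

End Exchange.

(** * Chains of simple factors and the comparison of two decompositions *)

Section Chains.
Context (k : fieldType) (H : hopfAlgType k).
Implicit Types (A B C D : hopfSub H).

Definition scalar_pred : {pred H} := [pred x : H | `[< exists c : k, x = c%:A >]].

Lemma scalar_predP (x : H) : reflect (exists c : k, x = c%:A) (x \in scalar_pred).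
Proof. exact: asboolP. Qed.

Fact scalar_subalg : GRing.subalg_closed scalar_pred.
Proof.
split; first by apply/scalar_predP; exists 1; rewrite scale1r.
  move=> c _ _ /scalar_predP[a ->] /scalar_predP[b ->]; apply/scalar_predP.
  by exists (c * a + b); rewrite scalerDl scalerA.
move=> _ _ /scalar_predP[a ->] /scalar_predP[b ->]; apply/scalar_predP.
by exists (a * b); rewrite -scalerAl mul1r scalerA.
Qed.

Fact scalar_comul x : x \in scalar_pred -> in_tensor scalar_pred (comul x).
Proof.
move=> /scalar_predP[c ->]; rewrite (linZ (@comul_linear _ H)) comul1 -tensZl.
by apply: in_tensor_tens; apply/scalar_predP; [exists c|exists 1; rewrite scale1r].
Qed.

Fact scalar_antipode x : x \in scalar_pred -> antipode x \in scalar_pred.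
Proof.
move=> /scalar_predP[c ->]; rewrite (linZ (@antipode_linear _ H)) antipode1.
by apply/scalar_predP; exists c.
Qed.

Definition scalar_hopfSub := HopfSub scalar_subalg scalar_comul scalar_antipode.

Lemma scalar_normal_integral : normal_integral scalar_hopfSub.
Proof.
split.
  move=> h _ /scalar_predP[c ->]; rewrite -!/(sweedler _ _); split.
    have -> : \cop (u, v <- h) (u * c%:A * antipode v) =
              \cop (u, v <- h) c *: (u * antipode v).
      by apply: eq_sweedler => u v; rewrite mulr_algr -scalerAl.
    rewrite (cop_antipoder h (f := fun z => c *: z)); last by lin.
    by apply/scalar_predP; exists (counit h * c); rewrite scalerA.
  have -> : \cop (u, v <- h) (antipode u * c%:A * v) =
            \cop (u, v <- h) c *: (antipode u * v).
    by apply: eq_sweedler => u v; rewrite mulr_algr -scalerAl.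
  rewrite (cop_antipodel h (f := fun z => c *: z)); last by lin.
  by apply/scalar_predP; exists (counit h * c); rewrite scalerA.
have epsZ (c : k) : counit (c%:A : H) = c.
  by rewrite (linZ (@counit_linear _ H)) counit1 [LHS]mulr1.
exists 1; split; first by apply/scalar_predP; exists 1; rewrite scale1r.
- by rewrite counit1.
- by move=> _ /scalar_predP[c ->]; rewrite epsZ mulr1.
- by move=> _ /scalar_predP[c ->]; rewrite epsZ mul1r.
Qed.

(** An ordered basis of C over B: each factor has to meet trivially only the product of B and the
    factors before it, which is the form that an exchange can update one step at a time. *)
Fixpoint chain (I : Type) (F : I -> hopfSub H) B (s : seq I) C : Prop :=
  if s is i :: s' then
    exists B', [/\ trivial_cap B (F i), normal_integral B', is_prod B (F i) B' & chain F B' s' C]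
  else B =i C.

Lemma prod_sub_eq A A' B : A =i A' -> forall x, prod_sub A B x -> prod_sub A' B x.
Proof.
move=> AA'; apply: prod_sub_ind; [exact: prod_sub0|exact: prod_subD|].
by move=> a b; rewrite AA'; exact: prod_subM.
Qed.

Section Family.
Context (I : Type) (F : I -> hopfSub H).
Hypothesis factorF : forall i, simple_factor (F i).

Lemma eq_chain B B' s C : B =i B' -> chain F B s C -> chain F B' s C.
Proof.
case: s => [|i s] /= BB'; first by move=> BC x; rewrite -BB'.
move=> [D [cap gD DE ch]]; exists D; split=> //.
  by move=> x; rewrite -BB'; exact: cap.
move=> x; split; first by move/DE; exact: prod_sub_eq.
by move=> xP; apply/DE; apply: prod_sub_eq xP => y; rewrite BB'.
Qed.

Lemma eq_chain_end B s C C' : C =i C' -> chain F B s C -> chain F B s C'.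
Proof.
move=> CC'; elim: s B => [|i s IH] B /=; first by move=> BC x; rewrite BC CC'.
by move=> [D [cap gD DE ch]]; exists D; split=> //; exact: IH.
Qed.

Lemma chain_sub B s C : chain F B s C -> forall x, x \in B -> x \in C.
Proof.
elim: s B => [|i s IH] B /=; first by move=> BC x; rewrite BC.
move=> [D [cap gD DE ch]] x xB; apply: (IH D) => //; apply/DE; exact: prod_subl.
Qed.

(** The factor deleted is the first one whose adjunction makes the partial product contain L; by
    simplicity, L meets all earlier partial products trivially. There the exchange applies, and the
    earlier factors stay independent over BL. *)
Lemma chain_exchange L s B C BL : simple_factor L -> normal_integral B -> chain F B s C ->
  trivial_cap B L -> (forall x, x \in L -> x \in C) -> normal_integral BL -> is_prod B L BL ->
  exists s1 i s2, [/\ s = s1 ++ i :: s2, hopf_iso (hopfSub_of (F i)) (hopfSub_of L) &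
                      chain F BL (s1 ++ s2) C].
Proof.
move=> aL; elim: s B BL => [|i s IH] B BL gB /=.
  move=> BC cap LC; case: (simple_nontrivial aL.2) => x xL; apply: cap => //.
  by rewrite BC; exact: LC.
move=> [B' [capi gB' B'E ch]] cap LC gBL BLE.
have [capL|LB'] := simple_cap aL.2 gB'.1; last first.
  have [iso B'L] := simple_factor_exchange gB (factorF i) aL capi cap B'E LB'.
  exists [::], i, s; split=> //; apply: eq_chain ch => x.
  by apply/idP/idP => [/B'L/BLE|/BLE/B'L].
have [D gD DE] := normal_integral_prod gB' aL.1 (trivial_capC capL).
have [s1 [j [s2 [-> iso ch']]]] := IH _ _ gB' ch (trivial_capC capL) LC gD DE.
(* If F i were contained in BL, the exchange would give BL = B (F i) = B', so L would lie in B',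
   against [capL]. *)
have capBL : trivial_cap BL (F i).
  have [/trivial_capC //|FBL] := simple_cap (factorF i).2 gBL.1.
  have [_ BLF] := simple_factor_exchange gB aL (factorF i) cap capi BLE FBL.
  case: (simple_nontrivial aL.2) => x xL; apply: capL => //.
  by apply/B'E/BLF/BLE; exact: prod_subr.
exists (i :: s1), j, s2; split=> //=; exists D; split=> //.
(* It remains to see (B F_i) L = (B L) F_i; D' is the right side as a Hopf subalgebra, closed under
   products. *)
have [D' _ D'E] := normal_integral_prod gBL (factorF i).1 capBL.
have BLD' x : x \in BL -> x \in D' by move=> xBL; apply/D'E; exact: prod_subl.
move=> x; split.
  move/DE => xP; apply/D'E; move: x xP; apply: prod_sub_le.
    move=> y /B'E; move: y; apply: prod_sub_le.
      by move=> y yB; apply/BLD'/BLE; exact: prod_subl.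
    by move=> y yF; apply/D'E; exact: prod_subr.
  by move=> y yL; apply/BLD'/BLE; exact: prod_subr.
move: x; apply: prod_sub_le.
  move=> y /BLE; move: y; apply: prod_sub_le.
    by move=> y yB; apply/DE/prod_subl/B'E/prod_subl.
  by move=> y yL; apply/DE/prod_subr.
by move=> y yF; apply/DE/prod_subl/B'E/prod_subr.
Qed.

End Family.

(** Induction on t over a growing base: B is enlarged by the head of t, while one isomorphic factor
    is deleted from the other chain. Once t is exhausted, B = C leaves no room for a nontrivial
    factor, so s is empty too. *)
Lemma chain_unique (I J : eqType) (F : I -> hopfSub H) (G : J -> hopfSub H) s t B C :
  (forall i, simple_factor (F i)) -> (forall j, simple_factor (G j)) -> normal_integral B ->
  chain F B s C -> chain G B t C ->
  exists2 s', perm_eq s' s & size s' = size t /\ forall i0 j0 n, (n < size t)%N ->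
    hopf_iso (hopfSub_of (F (nth i0 s' n))) (hopfSub_of (G (nth j0 t n))).
Proof.
move=> aF aG; elim: t s B => [|j t IH] s B gB /=.
  case: s => [|i s] /=; first by exists [::].
  move=> [B' [cap gB' B'E ch]] BC; case: (simple_nontrivial (aF i).2) => x xF.
  apply: cap => //; rewrite BC; apply: (chain_sub ch); apply/B'E; exact: prod_subr.
move=> chF [B1 [cap gB1 B1E chG]].
have GC x : x \in G j -> x \in C.
  by move=> xG; apply: (chain_sub chG); apply/B1E; exact: prod_subr.
have [s1 [i [s2 [-> iso ch]]]] := chain_exchange aF (aG j) gB chF cap GC gB1 B1E.
have [s' ps' [sz isos]] := IH _ _ gB1 ch chG.
exists (i :: s'); first by rewrite perm_sym -[i :: s2]cat1s perm_catCA /= perm_cons perm_sym.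
by split=> [|i0 j0 [|n]] //=; [rewrite sz|rewrite ltnS; exact: isos].
Qed.

Lemma internal_tensor_chain (I : finType) (F : I -> hopfSub H) C :
  (forall i, simple_factor (F i)) -> internal_tensor F -> (forall x, x \in C) ->
  chain F scalar_hopfSub (enum I) C.
Proof.
move=> aF [_ genF capF] CT.
(* Invariant: B lies in what the factors outside s generate. It therefore meets the next factor
   trivially, by the intersection condition of the decomposition. *)
have step s B : uniq s -> normal_integral B ->
    (forall x, x \in B -> hopf_gen (fun j => j \notin s) F x) ->
    exists D, [/\ chain F B s D, forall x, x \in B -> x \in D &
                  forall i, i \in s -> {subset F i <= D}].
  elim: s B => [|i s IH] B /=; first by exists B.
  move=> /andP[is_ us] gB Bgen.
  have cap : trivial_cap B (F i).
    move=> x xB xF; apply: (capF i) => // A FA; apply: (Bgen x xB) => j.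
    by rewrite inE negb_or => /andP[/eqP ji _]; exact: FA.
  have [B' gB' B'E] := normal_integral_prod gB (aF i).1 cap.
  have [|D [ch B'D sD]] := IH _ us gB'.
    move=> x /B'E xP A FA; move: x xP; apply: prod_sub_le.
      move=> y yB; apply: (Bgen y yB) => j; rewrite inE negb_or => /andP[_].
      exact: FA.
    exact: FA.
  exists D; split; first by exists B'.
    by move=> x xB; apply/B'D/B'E; exact: prod_subl.
  move=> j; rewrite inE => /predU1P[->|]; last exact: sD.
  by move=> x xF; apply/B'D/B'E; exact: prod_subr.
have [|D [ch _ FD]] := step _ _ (enum_uniq I) scalar_normal_integral.
  by move=> x /scalar_predP[c ->] A _; apply: rpredZ; exact: rpred1.
apply: eq_chain_end ch => x; rewrite CT; apply: (genF x D) => i _.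
by apply: FD; rewrite mem_enum.
Qed.

Lemma KSR_simple_factor (I : Type) (F : I -> hopfSub H) : KSR_decomposition F ->
  forall i, simple_factor (F i).
Proof.
move=> [[nF _ _] ssF] i; have [si ssi] := ssF i.
by split=> //; split; [exact: nF|exact: semisimple_sub_integral].
Qed.

(** Closed with [Defined], so that membership reduces to [true]. *)
Definition full_hopfSub : hopfSub H.
Proof.
apply: (@HopfSub k H predT); [by split|move=> x _|by []].
by have [s ->] := tensor_sumP (comul x); exists s => //; apply/allP.
Defined.

End Chains.

Theorem corollary4p6 (k : closedFieldType) (k_char0 : [pchar k] =i pred0)
    (H : hopfAlgType k) (r s : nat)
    (K : 'I_r -> hopfSub H) (L : 'I_s -> hopfSub H)
    (K_dec : KSR_decomposition K) (L_dec : KSR_decomposition L) :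
  exists (e : r = s) (sigma : 'S_r),
    forall i : 'I_r, hopf_iso (hopfSub_of (K i))
                              (hopfSub_of (L (cast_ord e (sigma i)))).
Proof.
have aK := KSR_simple_factor K_dec; have aL := KSR_simple_factor L_dec.
have CT x : x \in full_hopfSub H by [].
have chK := internal_tensor_chain aK K_dec.1 CT.
have chL := internal_tensor_chain aL L_dec.1 CT.
have [t pt [szt iso]] := chain_unique aK aL (scalar_normal_integral H) chK chL.
have e : r = s by move: (perm_size pt); rewrite szt !size_enum_ord.
subst s; exists erefl; rewrite size_enum_ord in szt iso.
have it (i : 'I_r) : i \in t by rewrite (perm_mem pt) mem_enum.
(* The permutation sends i to its position in the rearranged enumeration t of the K-indices, since
   the entry of t at position n is matched with the n-th factor L. *)
have lt_it (i : 'I_r) : (index i t < r)%N by rewrite -[X in (_ < X)%N]szt index_mem.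
have inj : injective (fun i => Ordinal (lt_it i)).
  by move=> i j /(congr1 val) /= ij; rewrite -(nth_index i (it i)) ij nth_index.
exists (perm inj) => i; rewrite permE cast_ord_id.
by have := iso i i _ (lt_it i); rewrite nth_index // (nth_ord_enum i (Ordinal (lt_it i))).
Qed.
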